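(* Let $\Omega\subset\mathbb{R}^d$ be compact with $d\ge2$, let $X_1,X_2,\ldots$ be i.i.d. in $\Omega$ with density $\varphi_P$ and $Y_1,Y_2,\ldots$ i.i.d. in $\Omega$ with density $\varphi_D$, all independent, and let $L^*(n)$ be the length of the optimal stacker crane tour through the pairs $(X_i,Y_i)$, $i=1,\ldots,n$. Let $X,Y$ be independent with densities $\varphi_P,\varphi_D$. If $d\ge3$, $$\limsup_{n\to\infty}\frac{L^*(n)-n\bigl[\mathbb{E}\|Y-X\|+W(\varphi_D,\varphi_P)\bigr]}{n^{1-1/d}}\le\kappa(\varphi_P,\varphi_D)\quad\text{almost surely},$$ where $\kappa(\varphi_P,\varphi_D)=\min_{\phi\in\{\varphi_P,\varphi_D\}}\beta_{M,d}\int_\Omega\phi(x)^{1-1/d}\,dx$. If $d=2$, there is a positive constant $\gamma$ such that, with probability tending to $1$ as $n\to\infty$, $$\frac{L^*(n)-n\bigl[\mathbb{E}\|Y-X\|+W(\varphi_D,\varphi_P)\bigr]}{\sqrt{n\log n}}\le\gamma.$$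
   Context: A stacker crane tour through pairs $(x_i,y_i)$ is a closed tour through all $x_i,y_i$ in which each pickup $x_i$ is immediately followed by its delivery $y_i$; its length is the sum of Euclidean distances along the tour. $W(\varphi_1,\varphi_2)=\inf_{\gamma\in\Gamma(\varphi_1,\varphi_2)}\int_{\Omega\times\Omega}\|y-x\|\,d\gamma(x,y)$ is the Euclidean Wasserstein distance, with $\Gamma(\varphi_1,\varphi_2)$ the set of measures on $\Omega\times\Omega$ with marginal densities $\varphi_1,\varphi_2$. For $d\ge3$, $\beta_{M,d}$ denotes the constant (known to exist from prior work) such that, whenever two independent $n$-point samples are i.i.d. from the same distribution on a compact $\Omega\subset\mathbb{R}^d$ with density $\varphi$, their optimal bipartite matching cost $L$ satisfies $\lim_n L/n^{1-1/d}=\beta_{M,d}\int_\Omega\overline{\varphi}(x)^{1-1/d}dx$ almost surely ($\overline\varphi$ the density of the absolutely continuous part). The densities are densities of absolutely continuous distributions. *)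

(* Defs.v *)
From HB Require Import structures.
From mathcomp Require Import all_boot all_order all_algebra all_fingroup.
From mathcomp Require Import all_classical all_reals all_analysis.
Set Implicit Arguments. Unset Strict Implicit. Unset Printing Implicit Defensive.
Import Order.TTheory GRing.Theory Num.Theory.
Import numFieldNormedType.Exports.
Local Open Scope classical_set_scope.
Local Open Scope ring_scope.

Section Defs.
Variables (R : realType) (d : nat).

Definition vecR := 'rV[R]_d.

(* Borel sigma-algebra on R^d: generated by the open sets
   (the topology of 'rV is the product = Euclidean topology) *)
Definition Rd : measurableType _ := g_sigma_algebraType (@open vecR).

Definition enorm (v : vecR) : R := Num.sqrt (\sum_(i < d) (v ord0 i) ^+ 2).

Definition box (a b : vecR) : set Rd :=
  [set x : Rd | forall i : 'I_d, a ord0 i <= x ord0 i <= b ord0 i].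

(* lam is d-dimensional Lebesgue measure (on the Borel sets): it gives every
   box its volume; this determines it uniquely on the Borel sigma-algebra *)
Definition is_lebesgue (lam : {measure set Rd -> \bar R}) : Prop :=
  forall a b : vecR, (forall i, a ord0 i <= b ord0 i) ->
    lam (box a b) = (\prod_(i < d) (b ord0 i - a ord0 i))%:E.

Definition is_density_on (lam : {measure set Rd -> \bar R})
    (Omega : set Rd) (phi : Rd -> R) : Prop :=
  [/\ measurable_fun setT phi, (forall x, 0 <= phi x),
      (forall x, ~ Omega x -> phi x = 0) &
      (\int[lam]_x (phi x)%:E = 1)%E].

Definition has_density {dT} {T : measurableType dT} (P : probability T R)
    (lam : {measure set Rd -> \bar R}) (Z : T -> Rd) (phi : Rd -> R) : Prop :=
  measurable_fun setT Z /\
  forall A : set Rd, measurable A ->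
    P (Z @^-1` A) = (\int[lam]_(x in A) (phi x)%:E)%E.

Definition mutually_independent {dT} {T : measurableType dT} {I : eqType}
    (P : probability T R) (Z : I -> T -> Rd) : Prop :=
  forall (J : seq I) (A : I -> set Rd), uniq J ->
    (forall j, measurable (A j)) ->
    P (\bigcap_(j in [set` J]) (Z j @^-1` A j)) =
      (\prod_(j <- J) P (Z j @^-1` A j))%E.

Definition match_cost (n : nat) (U V : nat -> Rd) : R :=
  let c (s : {perm 'I_n}) := \sum_(i < n) enorm (U i - V (s i)) in
  \big[Num.min/c 1%g]_(s : {perm 'I_n}) c s.

(* length of the stacker crane tour visiting the pairs in the cyclic order
   s 0, s 1, ..., s (n-1), s 0 : x_{s k} -> y_{s k} -> x_{s (k+1)} -> ... *)
Definition sct_tour_len (n : nat) (X Y : nat -> Rd) (s : {perm 'I_n}) : R :=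
  \sum_(k < n) (enorm (Y (s k) - X (s k)) + enorm (X (s (ordS k)) - Y (s k))).

Definition sct_opt (n : nat) (X Y : nat -> Rd) : R :=
  \big[Num.min/@sct_tour_len n X Y 1%g]_(s : {perm 'I_n}) @sct_tour_len n X Y s.

Definition mean_dist (lam : {measure set Rd -> \bar R}) (phiP phiD : Rd -> R) : R :=
  fine (\int[lam]_x \int[lam]_y ((enorm (y - x) * phiP x * phiD y)%:E))%E.

Definition coupling (lam : {measure set Rd -> \bar R}) (Omega : set Rd)
    (phi1 phi2 : Rd -> R) (gamma : probability (Rd * Rd)%type R) : Prop :=
  [/\ gamma (~` (Omega `*` Omega)) = 0%E,
      (forall A : set Rd, measurable A ->
         gamma (A `*` setT) = (\int[lam]_(x in A) (phi1 x)%:E)%E) &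
      (forall B : set Rd, measurable B ->
         gamma (setT `*` B) = (\int[lam]_(x in B) (phi2 x)%:E)%E)].

Definition wasserstein (lam : {measure set Rd -> \bar R}) (Omega : set Rd)
    (phi1 phi2 : Rd -> R) : \bar R :=
  ereal_inf [set c | exists gamma : probability (Rd * Rd)%type R,
     coupling lam Omega phi1 phi2 gamma /\
     c = (\int[gamma]_z (enorm (z.2 - z.1))%:E)%E].

Definition scale_d (n : nat) : R := powR n%:R (1 - d%:R^-1).

Definition matching_constant (lam : {measure set Rd -> \bar R}) (beta : R) : Prop :=
  forall (dT : measure_display) (T : measurableType dT) (P : probability T R)
         (Omega : set vecR) (phi : Rd -> R) (U V : nat -> T -> Rd),
    compact Omega -> is_density_on lam Omega phi ->
    (forall i, has_density P lam (U i) phi /\ has_density P lam (V i) phi) ->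
    mutually_independent P (fun bi : bool * nat =>
        if bi.1 then U bi.2 else V bi.2) ->
    {ae P, forall w, (fun n => match_cost n (U^~ w) (V^~ w) / scale_d n)
        @ \oo --> beta * Rintegral lam Omega (fun x => powR (phi x) (1 - d%:R^-1))}.

End Defs.

(* Main.v *)
Require Import Defs.
From HB Require Import structures.
From mathcomp Require Import all_boot all_order all_algebra all_fingroup.
From mathcomp Require Import all_classical all_reals all_analysis.
From mathcomp Require Import measurable_realfun ring lra.
Set Implicit Arguments. Unset Strict Implicit. Unset Printing Implicit Defensive.
Import Order.TTheory GRing.Theory Num.Theory.
Import numFieldNormedType.Exports.
Local Open Scope classical_set_scope.
Local Open Scope ring_scope.

(** Delivering along the pairs and returning along a permutation [s] that assigns
    to each delivery the next pickup costs the pair lengths plus the length of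
    [s], and merging the cycles of [s] into one tour costs at most two diameters
    per cycle.  Relabelling the deliveries at random makes the optimal [s] uniform,
    with harmonic mean number of cycles.

    The mean length of the optimal assignment between the two samples is compared
    with that between two samples of the same law by replacing the points one at
    a time along a nearly optimal coupling; this costs [n] times the Wasserstein
    distance, and for [d >= 3] leaves the term governed by the matching constant.
    The bounded difference inequality makes both the tour length and the matching
    cost concentrate at scale [sqrt n * ln n], negligible against [n^(1 - 1/d)],
    so that bounds on the means give almost sure bounds.

    For [d = 2] the matching of two samples of the same law is bounded by duality:
    a Lipschitz potential is integrated against the flow that sends each point
    along a Polya urn walk on a grid of mesh [1/sqrt n].  The urn walk is uniform
    on antidiagonals, so its flow has energy of order [ln n]; independence adds
    the energies of the points, and Cauchy-Schwarz gives [sqrt (n ln n)]. *)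

(** * Bounded measurable functions *)

(** Points lie in [Omega] only almost surely, whereas bounded differences must hold for every
    replacement of a point. Costs are therefore computed with the distance after retraction to
    [Omega]: it is bounded and measurable everywhere, and almost surely it is the Euclidean one.
    Independence is used only through the joint law, so that relabelling and splitting a sample are
    reindexings by injections.

    The matching constant governs almost sure limits, while the comparison of samples concerns
    means. Concentration links the two at a single typical outcome: the mean is bounded by one value
    of the matching cost, without a convergence theorem. The second sample of the same law comes
    from the same sequence, split by the parity of the index. Pickups and deliveries can both be the
    side that is replaced, whence the minimum in [kappa].

    In the plane the deviation [sqrt n * ln n] exceeds the scale [sqrt (n ln n)]. The deviation
    allowed there has a probability that vanishes too slowly to be summed, which is why that bound
    is stated in probability. *)

Section BoundedMeasurable.
Context d (T : measurableType d) (R : realType).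

Definition bmeas (f : T -> R) : Prop :=
  measurable_fun setT f /\ exists M : R, forall x, `|f x| <= M.

Lemma bmeas_cst (r : R) : bmeas (fun=> r).
Proof. by split; [exact: measurable_cst | exists `|r|]. Qed.

Lemma bmeasD (f g : T -> R) : bmeas f -> bmeas g -> bmeas (fun x => f x + g x).
Proof.
move=> [mf [M fM]] [mg [N gN]]; split; first exact: measurable_funD.
by exists (M + N) => x; rewrite (le_trans (ler_normD _ _))// lerD.
Qed.

Lemma bmeasM (f g : T -> R) : bmeas f -> bmeas g -> bmeas (fun x => f x * g x).
Proof.
move=> [mf [M fM]] [mg [N gN]]; split; first exact: measurable_funM.
by exists (M * N) => x; rewrite normrM ler_pM.
Qed.

Lemma bmeasZ (r : R) (f : T -> R) : bmeas f -> bmeas (fun x => r * f x).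
Proof. by move=> bf; apply: bmeasM => //; exact: bmeas_cst. Qed.

Lemma bmeasN (f : T -> R) : bmeas f -> bmeas (fun x => - f x).
Proof. by move=> /(bmeasZ (-1)); under eq_fun do rewrite mulN1r. Qed.

Lemma bmeasB (f g : T -> R) : bmeas f -> bmeas g -> bmeas (fun x => f x - g x).
Proof. by move=> bf bg; apply: bmeasD => //; exact: bmeasN. Qed.

Lemma bmeas_sum (I : Type) (s : seq I) (F : I -> T -> R) :
  (forall i, bmeas (F i)) -> bmeas (fun x => \sum_(i <- s) F i x).
Proof.
move=> bF; elim: s => [|i s IHs].
  by under eq_fun do rewrite big_nil; exact: bmeas_cst.
by under eq_fun do rewrite big_cons; exact: bmeasD.
Qed.

Lemma bmeas_min (f g : T -> R) : bmeas f -> bmeas g ->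
  bmeas (fun x => Num.min (f x) (g x)).
Proof.
move=> [mf [M fM]] [mg [N gN]]; split; first exact: measurable_minr.
by exists (M + N) => x; rewrite minEle; case: ifPn => _;
  rewrite (le_trans (fM _), le_trans (gN _)) ?lerDl ?lerDr//
    (le_trans _ (fM x), le_trans _ (gN x)).
Qed.

Lemma measurable_bigmin (I : Type) (s : seq I) (f0 : T -> R) (F : I -> T -> R) :
  measurable_fun setT f0 -> (forall i, measurable_fun setT (F i)) ->
  measurable_fun setT (fun x => \big[Num.min/f0 x]_(i <- s) F i x).
Proof.
move=> m0 mF; elim: s => [|i s IHs].
  by under eq_fun do rewrite big_nil.
by under eq_fun do rewrite big_cons; exact: measurable_minr.
Qed.

Lemma bmeas_bigmin (I : Type) (s : seq I) (f0 : T -> R) (F : I -> T -> R) :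
  bmeas f0 -> (forall i, bmeas (F i)) ->
  bmeas (fun x => \big[Num.min/f0 x]_(i <- s) F i x).
Proof.
move=> b0 bF; elim: s => [|i s IHs].
  by under eq_fun do rewrite big_nil.
by under eq_fun do rewrite big_cons; exact: bmeas_min.
Qed.

Lemma bmeas_exp (f : T -> R) : bmeas f -> bmeas (fun x => expR (f x)).
Proof.
move=> [mf [M fM]]; split; first exact: measurableT_comp.
exists (expR M) => x; rewrite gtr0_norm ?expR_gt0// ler_expR.
exact: le_trans (ler_norm _) (fM x).
Qed.

Lemma bmeas_norm (f : T -> R) : bmeas f -> bmeas (fun x => `|f x|).
Proof.
move=> [mf [M fM]]; split; first exact: measurableT_comp.
by exists M => x; rewrite normr_id.
Qed.

End BoundedMeasurable.

Lemma bmeas_comp d d' (T : measurableType d) (T' : measurableType d') (R : realType)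
    (g : T' -> T) (f : T -> R) :
  measurable_fun setT g -> bmeas f -> bmeas (f \o g).
Proof.
move=> mg [mf [M fM]]; split; first exact: measurableT_comp.
by exists M => x /=.
Qed.

Section Expectation.
Context d (T : measurableType d) (R : realType) (P : probability T R).

Lemma bmeas_integrable (f : T -> R) : bmeas f -> P.-integrable setT (EFin \o f).
Proof.
move=> [mf [M fM]]; apply: measurable_bounded_integrable => //.
  by rewrite /= probability_setT ltry.
exists M; split; first exact: num_real.
by move=> x Mx y _; apply: le_trans (fM y) (ltW Mx).
Qed.

Lemma EFin_bmeas_Rintegral (f : T -> R) : bmeas f ->
  ((\int[P]_w f w)%:E = \int[P]_w (f w)%:E)%E.
Proof.
move=> bf; rewrite /Rintegral fineK//.
exact: integrable_fin_num (bmeas_integrable bf).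
Qed.

Lemma probability_Rintegral_cst (r : R) : \int[P]_w r = r.
Proof. by rewrite Rintegral_cst//= probability_setT mulr1. Qed.

Lemma bmeas_RintegralD (f g : T -> R) : bmeas f -> bmeas g ->
  \int[P]_w (f w + g w) = \int[P]_w f w + \int[P]_w g w.
Proof. by move=> bf bg; rewrite RintegralD//; exact: bmeas_integrable. Qed.

Lemma bmeas_RintegralZl (r : R) (f : T -> R) : bmeas f ->
  \int[P]_w (r * f w) = r * \int[P]_w f w.
Proof. by move=> bf; rewrite RintegralZl//; exact: bmeas_integrable. Qed.

Lemma bmeas_RintegralB (f g : T -> R) : bmeas f -> bmeas g ->
  \int[P]_w (f w - g w) = \int[P]_w f w - \int[P]_w g w.
Proof. by move=> bf bg; rewrite RintegralB//; exact: bmeas_integrable. Qed.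

Lemma le_bmeas_Rintegral (f g : T -> R) : bmeas f -> bmeas g -> (forall w, f w <= g w) ->
  \int[P]_w f w <= \int[P]_w g w.
Proof. by move=> bf bg fg; apply: le_Rintegral => //; exact: bmeas_integrable. Qed.

Lemma bmeas_Rintegral_sum (I : Type) (s : seq I) (F : I -> T -> R) : (forall i, bmeas (F i)) ->
  \int[P]_w (\sum_(i <- s) F i w) = \sum_(i <- s) \int[P]_w F i w.
Proof.
move=> bF; elim: s => [|i s IHs].
  by under eq_Rintegral do rewrite big_nil; rewrite big_nil probability_Rintegral_cst.
under eq_Rintegral do rewrite big_cons.
by rewrite big_cons bmeas_RintegralD ?IHs//; exact: bmeas_sum.
Qed.

End Expectation.

Section Pushforward.
Context d (T : measurableType d) (R : realType) (P : probability T R).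
Context d' (T' : measurableType d').

Lemma Rintegral_pushforward (Q : {measure set T' -> \bar R}) (g : T -> T') (f : T' -> R) :
  measurable_fun setT g -> bmeas f ->
  (forall A, measurable A -> Q A = P (g @^-1` A)) ->
  \int[Q]_x f x = \int[P]_w f (g w).
Proof.
move=> mg bf QE; rewrite /Rintegral; congr fine.
have mf : measurable_fun setT (EFin \o f) by apply/measurable_EFinP; case: bf.
rewrite (eq_measure_integral (pushforward P g)); last first.
  by move=> A mA _; rewrite QE.
rewrite integral_pushforward//.
by apply: (bmeas_integrable P (f := f \o g)); exact: bmeas_comp.
Qed.

End Pushforward.

(** * Independent families *)

Section Cylinders.
Context dE (E : measurableType dE) (I : eqType).

(** Index lists are finite and without repetition, as in the product formula of independence, which
    thus gives the probability of each cylinder at once. Cylinders are stable under intersection, so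
    they determine a law on [conf]. *)
Definition cylinder : set (set (I -> E)) :=
  [set C | exists (J : seq I) (A : I -> set E),
     [/\ uniq J, (forall j, measurable (A j)) &
         C = \bigcap_(j in [set` J]) ((fun z => z j) @^-1` A j)]].

Definition conf : measurableType _ := g_sigma_algebraType cylinder.

Lemma measurable_coord (j : I) : measurable_fun setT (fun z : conf => z j).
Proof.
move=> _ A mA; rewrite setTI; apply: sub_sigma_algebra.
exists [:: j], (fun=> A); split => //.
apply/seteqP; split => [z Az i /=|z /(_ j)/=].
  by rewrite inE => /eqP ->.
by apply; rewrite inE.
Qed.

Lemma cylinder_setI : setI_closed cylinder.
Proof.
move=> _ _ [J1 [A1 [u1 m1 ->]]] [J2 [A2 [u2 m2 ->]]].
pose B (J : seq I) (A : I -> set E) j := if j \in J then A j else setT.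
exists (undup (J1 ++ J2)), (fun j => B J1 A1 j `&` B J2 A2 j); split.
- exact: undup_uniq.
- by move=> j; apply: measurableI; rewrite /B; case: ifP.
- apply/seteqP; split => [z [z1 z2] j /=|z zB].
    rewrite mem_undup mem_cat /B => _; split; case: ifP => // jJ.
    + exact: z1.
    + exact: z2.
  split => j /= jJ; have := zB j; rewrite /= mem_undup mem_cat jJ ?orbT /B;
    by move=> /(_ isT); rewrite jJ; case.
Qed.

Lemma measurable_conf d (T : measurableType d) (Z : T -> conf) :
  (forall j, measurable_fun setT (fun w => Z w j)) -> measurable_fun setT Z.
Proof.
move=> mZ; apply: (@measurability _ _ _ conf setT Z cylinder) => //.
move=> _ [_ [J [A [uJ mA ->]]] <-]; rewrite setTI.
rewrite preimage_bigcap; apply: fin_bigcap_measurable.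
  exact: finite_seq.
by move=> j _; rewrite -[X in measurable X]setTI; exact: mZ.
Qed.

End Cylinders.

Section Independence.
Context (R : realType) dE (E : measurableType dE) (I : eqType).

Definition indep d (T : measurableType d) (P : probability T R)
    (Z : I -> T -> E) : Prop :=
  (forall j, measurable_fun setT (Z j)) /\
  forall (J : seq I) (A : I -> set E), uniq J -> (forall j, measurable (A j)) ->
    P (\bigcap_(j in [set` J]) (Z j @^-1` A j)) =
      (\prod_(j <- J) P (Z j @^-1` A j))%E.

Definition law_eq d d' (T : measurableType d) (T' : measurableType d')
    (P : probability T R) (P' : probability T' R) (X : T -> E) (X' : T' -> E) :=
  forall A, measurable A -> P (X @^-1` A) = P' (X' @^-1` A).

(** The product formula fixes the joint law on cylinders, a pi-system generating the sigma-algebra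
    of [conf], so the laws of the coordinates determine every mean. Later exchanges of variables go
    through this lemma. *)
Lemma indep_Rintegral_eq d d' (T : measurableType d) (T' : measurableType d')
    (P : probability T R) (P' : probability T' R)
    (Z : I -> T -> E) (Z' : I -> T' -> E) (f : conf E I -> R) :
  indep P Z -> indep P' Z' -> (forall j, law_eq P P' (Z j) (Z' j)) ->
  bmeas f ->
  \int[P]_w f (fun j => Z j w) = \int[P']_w f (fun j => Z' j w).
Proof.
move=> [mZ iZ] [mZ' iZ'] ZZ' bf.
pose z w : conf E I := fun j => Z j w.
pose z' w : conf E I := fun j => Z' j w.
have mz : measurable_fun setT z by exact: measurable_conf.
have mz' : measurable_fun setT z' by exact: measurable_conf.
rewrite -(Rintegral_pushforward (Q := pushforward P z) mz bf) //.
apply: (Rintegral_pushforward mz' bf) => A mA.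
pose m1 : {measure set conf E I -> \bar R} := pushforward P z.
pose m2 : {measure set conf E I -> \bar R} := pushforward P' z'.
change (m1 mz A = m2 mz' A).
apply: (@measure_unique _ _ (conf E I) (@cylinder _ E I) (fun=> setT)) => //.
- exact: cylinder_setI.
- move=> _; exists [::], (fun=> setT); split => //.
  by apply/seteqP; split => // x _ j.
- by apply/seteqP; split => // x _; exists 0%N.
- move=> _ [J [B [uJ mB ->]]]; rewrite /m1 /m2 /= /pushforward !preimage_bigcap.
  rewrite [LHS]iZ// [RHS]iZ'//; apply: eq_bigr => j _; exact: ZZ'.
- by move=> _; rewrite /m1 /= /pushforward preimage_setT probability_setT ltry.
Qed.

Definition upd (z : I -> E) (j : I) (u : E) : I -> E :=
  fun i => if i == j then u else z i.

(** The fresh value lives on the second factor of a product space, hence is independent of the rest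
    whatever its law. This covers both an independent copy of [Z j] and the marginals of a coupling,
    which can be compared when both are read off the same second factor. *)
Lemma indep_resample d d' (T : measurableType d) (T' : measurableType d')
    (P : probability T R) (P' : probability T' R)
    (Z : I -> T -> E) (j : I) (zeta : T' -> E) :
  indep P Z -> measurable_fun setT zeta ->
  let Z' i (w : T * T') := upd (Z^~ w.1) j (zeta w.2) i in
  [/\ indep (P \x P')%E Z',
      forall i, i != j -> law_eq (P \x P')%E P (Z' i) (Z i) &
      law_eq (P \x P')%E P' (Z' j) zeta].
Proof.
move=> [mZ iZ] mzeta Z'.
have mpre i A : measurable A -> measurable (Z i @^-1` A).
  by move=> mA; rewrite -[X in measurable X]setTI; exact: mZ.
have mprez A : measurable A -> measurable (zeta @^-1` A).
  by move=> mA; rewrite -[X in measurable X]setTI; exact: mzeta.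
have L1 i : i != j -> law_eq (P \x P')%E P (Z' i) (Z i).
  move=> ij A mA; rewrite (_ : Z' i @^-1` A = Z i @^-1` A `*` setT).
    by rewrite [LHS]product_measure1E//= ?probability_setT ?mule1//; exact: mpre.
  by apply/seteqP; split => [[w w']|[w w'] []]; rewrite /Z' /upd /= (negbTE ij).
have L2 : law_eq (P \x P')%E P' (Z' j) zeta.
  move=> A mA; rewrite (_ : Z' j @^-1` A = setT `*` zeta @^-1` A).
    by rewrite [LHS]product_measure1E//= ?probability_setT ?mul1e//; exact: mprez.
  by apply/seteqP; split => [[w w']|[w w'] []]; rewrite /Z' /upd /= eqxx.
split => //; split => [i|J A uJ mA].
  rewrite /Z' /upd; case: eqVneq => _.
    exact: measurableT_comp.
  exact: measurableT_comp.
pose B := if j \in J then A j else setT.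
have mB : measurable B by rewrite /B; case: ifP.
rewrite (_ : \bigcap_(i in _) _ =
  (\bigcap_(i in [set` [seq i <- J | i != j]]) (Z i @^-1` A i)) `*` (zeta @^-1` B)).
  rewrite [LHS]product_measure1E//=; [|apply: fin_bigcap_measurable; [exact: finite_seq|by move=> i _; exact: mpre]|exact: mprez].
  rewrite iZ ?filter_uniq//.
  have [jJ|jJ] := boolP (j \in J).
    rewrite [RHS](perm_big _ (perm_to_rem jJ))/= big_cons muleC rem_filter//.
    congr (_ * _)%E; first by rewrite L2// /B jJ.
    rewrite !big_filter/=; rewrite [RHS](eq_bigr (fun i => P (Z i @^-1` A i)))// => i ij.
    exact: L1.
  rewrite /B (negbTE jJ) preimage_setT probability_setT mule1.
  rewrite (_ : [seq i <- J | i != j] = J).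
    rewrite [RHS](eq_big_seq (fun i => P (Z i @^-1` A i)))// => i iJ.
    by apply: L1 => //; apply: contraNneq jJ => <-.
  by apply/all_filterP/allP => i iJ; apply: contraNneq jJ => <-.
apply/seteqP; split => [[w w'] H|[w w'] [/= H1 H2] i iJ].
  split => /=.
    move=> i /=; rewrite mem_filter => /andP[ij iJ].
    by have := H i iJ; rewrite /Z' /upd /= (negbTE ij).
  rewrite /B; case: ifPn => // jJ.
  by have := H j jJ; rewrite /Z' /upd /= eqxx.
rewrite /Z' /upd /=; case: eqVneq => [ij|ij].
  by move: H2; rewrite /B -ij iJ.
by apply: H1; rewrite /= mem_filter ij.
Qed.

End Independence.

Lemma indep_inj (R : realType) dE (E : measurableType dE) (I I' : eqType)
    d (T : measurableType d) (P : probability T R)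
    (Z : I' -> T -> E) (h : I -> I') :
  injective h -> indep P Z -> indep P (fun j => Z (h j)).
Proof.
move=> hinj [mZ iZ]; split => // J A uJ mA.
(* [A'] is empty at indices outside the range of [h]; this is harmless, since only those in
   [map h J] are tested. *)
have [A' A'E mA'] : exists2 A' : I' -> set E, (forall j, A' (h j) = A j) &
    forall k, measurable (A' k).
  exists (fun k => [set x | exists2 j, h j = k & A j x]) => [j|k].
    by apply/seteqP; split => [x [i /hinj ->]//|x Ax]; exists j.
  have [[j <-]|nk] := pselect (exists j, h j = k).
    rewrite (_ : [set x | _] = A j)//.
    by apply/seteqP; split => [x [i /hinj ->]//|x Ax]; exists j.
  rewrite (_ : [set x | _] = set0)//.
  by apply/seteqP; split => // x [j hj _]; apply: nk; exists j.
have := iZ (map h J) A'; rewrite map_inj_uniq// => /(_ uJ mA').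
rewrite big_map => E1; transitivity (\prod_(j <- J) P (Z (h j) @^-1` A' (h j)))%E.
  rewrite -E1; congr (P _); apply/seteqP; split => [w Hw k /= /mapP[j jJ ->]|w Hw j jJ].
    by rewrite A'E; exact: Hw.
  by have := Hw (h j); rewrite /= A'E; apply; exact: map_f.
by apply: eq_bigr => j _; rewrite A'E.
Qed.

(** * The bounded difference inequality *)

Section FubiniBounded.
Context (R : realType) d1 d2 (T1 : measurableType d1) (T2 : measurableType d2).

Lemma bmeas_fubini (P2 : probability T2 R) (h : T1 * T2 -> R) :
  bmeas h -> bmeas (fun x => \int[P2]_y h (x, y)).
Proof.
move=> [mh [M hM]].
have bh x : bmeas (fun y => h (x, y)).
  by apply: (@bmeas_comp _ _ _ _ _ (pair x)) => //; split => //; exists M.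
split; last first.
  exists M => x; rewrite ler_norml -{1}(probability_Rintegral_cst P2 (- M)) -{2}(probability_Rintegral_cst P2 M).
  by apply/andP; split; apply: le_bmeas_Rintegral => //; try exact: bmeas_cst;
    move=> y; have := hM (x, y); rewrite ler_norml => /andP[].
(* Adding the bound [M] makes the integrand nonnegative, as Tonelli's measurability statement
   requires. *)
rewrite (_ : (fun x => _) = fun x => \int[P2]_y (h (x, y) + M) - M); last first.
  by apply/funext => x; rewrite bmeas_RintegralD ?probability_Rintegral_cst ?addrK//; exact: bmeas_cst.
apply: measurable_funB => //.
apply: (@measurableT_comp _ _ _ _ _ _ fine _ (fun x => \int[P2]_y (h (x, y) + M)%:E)%E).
  by [].
apply: (@measurable_fun_fubini_tonelli_F _ _ _ _ _ P2 (fun z => (h z + M)%:E)).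
- exact/measurable_EFinP/measurable_funD.
- by move=> z; rewrite lee_fin -lerBlDr sub0r; have := hM z; rewrite ler_norml => /andP[].
Qed.

Lemma bmeas_fubini_Rintegral (P1 : probability T1 R) (P2 : probability T2 R) (h : T1 * T2 -> R) :
  bmeas h -> \int[(P1 \x P2)%E]_z h z = \int[P1]_x \int[P2]_y h (x, y).
Proof.
move=> bh; rewrite /Rintegral; congr fine.
rewrite -(@integral12_prod_meas1 _ _ _ _ _ P1 P2 (EFin \o h)); last first.
  exact: bmeas_integrable.
apply: eq_integral => x _; rewrite EFin_bmeas_Rintegral//.
exact: (@bmeas_comp _ _ _ _ _ (pair x)).
Qed.

End FubiniBounded.

(** From [1 - x <= expR (- x)] follows [expR x <= 1 / (1 - x)], and [(1 + x + 2 x^2) (1 - x) = 1 +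
    x^2 (1 - 2 x)] is at least [1] when [x <= 1/2]. *)
Lemma expR_le_quad (R : realType) (x : R) : x <= 2^-1 -> expR x <= 1 + x + 2 * x ^+ 2.
Proof.
move=> x2; have x1 : 0 < 1 - x by lra.
have : expR x * (1 - x) <= 1.
  rewrite -[leRHS](expRxMexpNx_1 x) ler_pM2l ?expR_gt0//.
  by rewrite expR_ge1Dx.
rewrite -ler_pdivlMr// => /le_trans; apply.
rewrite ler_pdivrMr//; nra.
Qed.

Section McDiarmid.
Context (R : realType) dE (E : measurableType dE) (I : eqType).
Context d (T : measurableType d) (P : probability T R) (Z : I -> T -> E).
Hypothesis iZ : indep P Z.

Lemma measurable_upd (j : I) :
  measurable_fun setT (fun zu : conf E I * T => upd zu.1 j (Z j zu.2) : conf E I).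
Proof.
apply: measurable_conf => i; rewrite /upd; case: eqVneq => _.
  by apply: measurableT_comp => //; case: iZ.
exact: (measurableT_comp (measurable_coord i)).
Qed.

Lemma measurable_family : measurable_fun setT (fun w => Z^~ w : conf E I).
Proof. by apply: measurable_conf => j; case: iZ. Qed.

(** Redrawing one coordinate keeps the joint law; the inner integral plays the role of the
    conditional expectation given the other coordinates. *)
Lemma Rintegral_resample (j : I) (g : conf E I -> R) : bmeas g ->
  \int[P]_w g (Z^~ w) = \int[P]_w \int[P]_v g (upd (Z^~ w) j (Z j v)).
Proof.
move=> bg; have [mZ _] := iZ.
have [iZ' L1 L2] := indep_resample P j iZ (mZ j).
rewrite -(bmeas_fubini_Rintegral P P (h := fun wv => g (upd (Z^~ wv.1) j (Z j wv.2)))).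
  apply: (indep_Rintegral_eq iZ iZ') => // i A mA; apply/esym.
  by have [->|ij] := eqVneq i j; [exact: L2 | exact: L1].
apply: (@bmeas_comp _ _ _ _ _
  (fun wv : T * T => upd (Z^~ wv.1) j (Z j wv.2) : conf E I)) => //.
by apply: measurable_conf => i; case: iZ'.
Qed.

(** Induction on the coordinates that [f] depends on: integrating out [j] leaves a function of the
    others with the same bounded differences, at the price of one factor
    [expR (2 * (s * c) ^+ 2)]. *)
Lemma mcdiarmid_mgf (c s : R) (J : seq I) (f : conf E I -> R) :
  0 <= c -> `|s| * c <= 2^-1 -> bmeas f ->
  (forall z z', (forall j, j \in J -> z j = z' j) -> f z = f z') ->
  (forall z j u, `|f (upd z j u) - f z| <= c) ->
  \int[P]_w expR (s * f (Z^~ w)) <=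
    expR (s * \int[P]_w f (Z^~ w)) * expR ((size J)%:R * (2 * (s * c) ^+ 2)).
Proof.
move=> c0 sc; elim: J f => [|j J IHJ] f bf fJ fc.
  have fE z z' : f z = f z' by exact: fJ.
  have t0 : T by exact: point.
  rewrite mul0r expR0 mulr1.
  have -> : (fun w => f (Z^~ w)) = cst (f (Z^~ t0)) by apply/funext => w; exact: fE.
  rewrite probability_Rintegral_cst.
  have -> : (fun w => expR (s * f (Z^~ w))) = cst (expR (s * f (Z^~ t0))).
    by apply/funext => w; rewrite (fE _ (Z^~ t0)).
  by rewrite probability_Rintegral_cst.
pose fb (z : conf E I) := \int[P]_v f (upd z j (Z j v)).
have bfu : bmeas (fun zu : conf E I * T => f (upd zu.1 j (Z j zu.2))).
  exact: (bmeas_comp (measurable_upd j) bf).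
have bfz z : bmeas (fun v => f (upd z j (Z j v))).
  exact: (@bmeas_comp _ _ _ _ _ (pair (z : conf E I)) _ (pair1_measurable _) bfu).
have bfb : bmeas fb by exact: (bmeas_fubini P bfu).
have bbase (g : conf E I -> R) : bmeas g -> bmeas (fun w => g (Z^~ w)).
  by move=> bg; exact: (bmeas_comp measurable_family bg).
have Efb : \int[P]_w f (Z^~ w) = \int[P]_w fb (Z^~ w) by exact: Rintegral_resample.
have upd_upd (z : I -> E) u v : upd (upd z j u) j v = upd z j v.
  by apply/funext => i; rewrite /upd; case: (i == j).
have fbc z v : `|f (upd z j (Z j v)) - fb z| <= c.
  have bd v' : `|f (upd z j (Z j v)) - f (upd z j (Z j v'))| <= c.
    by rewrite -(upd_upd z (Z j v') (Z j v)); exact: fc.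
  rewrite ler_norml; apply/andP; split.
    rewrite lerBrDl -lerBrDr opprK addrC -{1}(probability_Rintegral_cst P (f (upd z j (Z j v)))).
    rewrite -{1}(probability_Rintegral_cst P c) -bmeas_RintegralD//; [|exact: bmeas_cst|exact: bmeas_cst].
    apply: le_bmeas_Rintegral => //; first by apply: bmeasD; exact: bmeas_cst.
    by move=> v'; have := bd v'; rewrite ler_norml => /andP[]; lra.
  rewrite lerBlDr -{1}(probability_Rintegral_cst P (f (upd z j (Z j v)))).
  rewrite -{1}(probability_Rintegral_cst P c) -bmeas_RintegralD//; last exact: bmeas_cst.
  apply: le_bmeas_Rintegral => //; [exact: bmeas_cst|by apply: bmeasD => //; exact: bmeas_cst|].
  by move=> v'; have := bd v'; rewrite ler_norml => /andP[]; lra.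
have inner z : \int[P]_v expR (s * f (upd z j (Z j v))) <=
    expR (s * fb z) * expR (2 * (s * c) ^+ 2).
  (* [fb z] is the mean over [v], so the linear term of the quadratic bound integrates to zero. *)
  apply: (@le_trans _ _ (\int[P]_v (expR (s * fb z) *
      (1 + 2 * (s * c) ^+ 2 + s * (f (upd z j (Z j v)) - fb z))))).
    apply: le_bmeas_Rintegral.
    - exact/bmeas_exp/bmeasZ.
    - apply: bmeasZ; apply: bmeasD; first exact: bmeas_cst.
      by apply: bmeasZ; apply: bmeasB => //; exact: bmeas_cst.
    - move=> v; set x := f _.
      rewrite (_ : s * x = s * fb z + s * (x - fb z)); last by ring.
      rewrite expRD ler_pM2l ?expR_gt0//.
      have xc : `|s * (x - fb z)| <= `|s| * c.
        by rewrite normrM ler_wpM2l//; exact: fbc.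
      have := @expR_le_quad _ (s * (x - fb z)).
      move=> /(_ (le_trans (ler_norm _) (le_trans xc sc))) /le_trans; apply.
      rewrite -addrA [leRHS]addrAC -addrA lerD2l addrC [leRHS]addrC lerD2r ler_pM2l//.
      rewrite -(real_normK (num_real (s * (x - fb z)))) -(real_normK (num_real (s * c))).
      by rewrite ler_sqr ?nnegrE// normrM [leRHS]normrM ler_wpM2l// (le_trans (fbc _ _)) ?ler_norm.
  have bsub : bmeas (fun v => s * (f (upd z j (Z j v)) - fb z)).
    by apply: bmeasZ; apply: bmeasB => //; exact: bmeas_cst.
  rewrite bmeas_RintegralZl; last by apply: bmeasD => //; exact: bmeas_cst.
  rewrite ler_pM2l ?expR_gt0// bmeas_RintegralD//; last exact: bmeas_cst.
  rewrite probability_Rintegral_cst bmeas_RintegralZl; last by apply: bmeasB => //; exact: bmeas_cst.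
  rewrite bmeas_RintegralB//; last exact: bmeas_cst.
  by rewrite probability_Rintegral_cst subrr mulr0 addr0 expR_ge1Dx.
have bexp : bmeas (fun z => expR (s * f z)) by exact/bmeas_exp/bmeasZ.
rewrite (Rintegral_resample j bexp).
have bin : bmeas (fun z : conf E I => \int[P]_v expR (s * f (upd z j (Z j v)))).
  apply: (bmeas_fubini P (h := fun zu : conf E I * T => expR (s * f (upd zu.1 j (Z j zu.2))))).
  exact/bmeas_exp/bmeasZ.
have {inner} := le_bmeas_Rintegral P (bbase _ bin)
  (bbase _ (bmeasM (bmeas_exp (bmeasZ s bfb)) (bmeas_cst _ _))) (fun w => inner (Z^~ w)).
move=> /le_trans; apply.
under eq_Rintegral do rewrite mulrC.
rewrite bmeas_RintegralZl; last exact: (bbase _ (bmeas_exp (bmeasZ s bfb))).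
rewrite /= Efb mulrC [X in _ <= _ * expR X](_ : _ =
  (size J)%:R * (2 * (s * c) ^+ 2) + 2 * (s * c) ^+ 2); last first.
  by rewrite -natr1 mulrDl mul1r.
rewrite expRD mulrA ler_wpM2r ?expR_ge0//; apply: IHJ => //.
  move=> z z' zz'; rewrite /fb; congr (Rintegral _ _ _); apply/funext => v.
  apply: fJ => i; rewrite inE /upd; case: eqVneq => //= _; exact: zz'.
move=> z i u; rewrite /fb -bmeas_RintegralB//.
have [->|ij] := eqVneq i j.
  under eq_Rintegral do rewrite upd_upd subrr.
  by rewrite probability_Rintegral_cst normr0.
have updC v : upd (upd z i u) j (Z j v) = upd (upd z j (Z j v)) i u.
  apply/funext => k; rewrite /upd; case: eqVneq => [->|//].
  by rewrite eq_sym (negbTE ij).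
rewrite ler_norml -{1}(probability_Rintegral_cst P (- c)) -{2}(probability_Rintegral_cst P c); apply/andP; split;
  apply: le_bmeas_Rintegral; rewrite ?(bmeas_cst, bmeasB)//; try exact: bmeas_cst; try (by apply: bmeasB);
  by move=> v; have := fc (upd z j (Z j v)) i u; rewrite -updC ler_norml => /andP[].
Qed.

Lemma mcdiarmid_tail (c s t : R) (J : seq I) (f : conf E I -> R) :
  0 <= c -> 0 <= s -> s * c <= 2^-1 -> bmeas f ->
  (forall z z', (forall j, j \in J -> z j = z' j) -> f z = f z') ->
  (forall z j u, `|f (upd z j u) - f z| <= c) ->
  (P [set w | (\int[P]_v f (Z^~ v) + t <= f (Z^~ w))%R] <=
    (expR ((size J)%:R * (2 * (s * c) ^+ 2) - s * t))%:E)%E.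
Proof.
move=> c0 s0 sc bf fJ fc; set m := \int[P]_w _; set A := [set w | _].
have bfZ : bmeas (fun w => f (Z^~ w)) by exact: (bmeas_comp measurable_family bf).
have mA : measurable A.
  have -> : A = setT `&` [set w | m + t <= f (Z^~ w)] by rewrite setTI.
  by apply: measurable_fun_le => //; case: bfZ.
have := @mcdiarmid_mgf c s J f c0 _ bf fJ fc; rewrite ger0_norm// => /(_ sc).
set K := expR ((size J)%:R * _) => HK.
rewrite expRD -/K -[P A]fineK ?fin_num_measure// lee_fin.
have -> : fine (P A) = \int[P]_w \1_A w.
  by rewrite /Rintegral integral_indic// setIT.
have b1 : bmeas (\1_A : T -> R).
  split; first exact: measurable_indic.
  by exists 1 => x; rewrite indicE; case: (_ \in _); rewrite ?normr1 ?normr0.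
apply: (@le_trans _ _ (\int[P]_w (expR (- s * (m + t)) * expR (s * f (Z^~ w))))).
  apply: le_bmeas_Rintegral => //; first exact/bmeasZ/bmeas_exp/bmeasZ.
  move=> w; rewrite indicE; case: (boolP (w \in A)) => [|_] /=; last first.
    by rewrite mulr_ge0 ?expR_ge0.
  rewrite inE /A /= => mw; rewrite -expRD -expR0 ler_expR.
  by rewrite mulNr addrC subr_ge0 ler_wpM2l.
rewrite bmeas_RintegralZl; last exact/bmeas_exp/bmeasZ.
apply: (@le_trans _ _ (expR (- s * (m + t)) * (expR (s * m) * K))).
  by rewrite ler_wpM2l// expR_ge0.
rewrite mulrA -expRD mulrC ler_wpM2l ?expR_ge0// ler_expR; lra.
Qed.

End McDiarmid.

(** * Tours, assignments and cycles of permutations *)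

Section MinPerm.
Context (R : realType) (n : nat).

(** The default [c 1%g] is itself a competitor, so the value is the true minimum for every [n],
    including [0]. *)
Definition minperm (c : {perm 'I_n} -> R) : R := \big[Num.min/c 1%g]_s c s.

Lemma minperm_le c s : minperm c <= c s.
Proof. exact: bigmin_le. Qed.

Lemma minperm_ex c : exists s, minperm c = c s.
Proof.
have /bigmin_leP[h|[s _ h]] : \big[Num.min/c 1%g]_(s : {perm 'I_n}) c s <= minperm c.
- by rewrite lexx.
- by exists 1%g; apply/eqP; rewrite eq_le h minperm_le.
- by exists s; apply/eqP; rewrite eq_le h minperm_le.
Qed.

End MinPerm.

Section Tours.
Context (R : realType) (E : Type) (ell : E -> E -> R) (n : nat).
Implicit Types (x y : 'I_n -> E) (s : {perm 'I_n}).

Definition tour_len x y s : R :=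
  \sum_(k < n) (ell (y (s k)) (x (s k)) + ell (x (s (ordS k))) (y (s k))).

Definition tour_min x y : R := minperm (tour_len x y).

Definition assign_len x y s : R := \sum_(i < n) ell (x i) (y (s i)).

Definition assign_min x y : R := minperm (assign_len x y).

(** With a single orbit the iterates of [s] from one point list all indices, and visiting the pairs
    in that order makes the empty leg out of pair [i] lead to the pickup [s i]. The bound [<= 1]
    admits [n = 0], where there is no orbit. *)
Lemma cyclic_tour x y s : (#|porbits s| <= 1)%N ->
  tour_min x y <= \sum_(i < n) ell (y i) (x i) + \sum_(i < n) ell (x (s i)) (y i).
Proof.
move=> s1; have [n0|n0] := posnP n.
  apply: le_trans (minperm_le _ 1%g) _; rewrite /tour_len !big1 ?addr0// => i;
  by case: i => i ilt; exfalso; rewrite n0 in ilt.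
pose i0 := Ordinal n0.
have orbT i : porbit s i = porbit s i0.
  have /cards1P[B sB] : #|porbits s| == 1%N.
    rewrite eqn_leq s1 card_gt0; apply/set0Pn; exists (porbit s i0).
    by rewrite imset_f.
  have : porbit s i \in porbits s by rewrite imset_f.
  have : porbit s i0 \in porbits s by rewrite imset_f.
  by rewrite sB !inE => /eqP -> /eqP ->.
have cT : #|porbit s i0| = n.
  rewrite -[RHS]card_ord; apply: eq_card => i.
  by rewrite -eq_porbit_mem orbT eqxx inE.
pose q (k : 'I_n) : 'I_n := iter k s i0.
have q_inj : injective q.
  move=> a b ab; apply/val_inj => /=.
  have := uniq_traject_porbit s i0; rewrite cT => u.
  apply/eqP; rewrite -(nth_uniq i0 _ _ u) ?size_traject ?ltn_ord//.
  by rewrite !nth_traject ?ltn_ord//; apply/eqP.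
(* At the last position [ordS] wraps to [0], and [n] iterations of [s] return to [i0]. *)
have qS k : q (ordS k) = s (q k).
  rewrite /q /=; have [kn|kn] := ltnP k.+1 n; first by rewrite modn_small.
  have -> : k.+1 = n by apply/eqP; rewrite eqn_leq kn ltn_ord.
  rewrite modnn /= -[LHS](iter_porbit s i0) cT.
  by rewrite -iterS; congr (iter _ s i0); apply/eqP; rewrite eqn_leq kn ltn_ord.
apply: le_trans (minperm_le _ (perm q_inj)) _.
rewrite /tour_len big_split /=; under eq_bigr do rewrite !permE.
under [X in _ + X <= _]eq_bigr do rewrite !permE qS.
rewrite le_eqVlt; apply/orP; left; apply/eqP.
by congr (_ + _); apply/esym; rewrite (reindex_inj q_inj).
Qed.

(* Two cycles of [s] are merged by a transposition, which changes two links. *)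
Lemma tour_le_cycles (D : R) x y s :
  0 <= D -> (forall u v, 0 <= ell u v <= D) ->
  tour_min x y <= \sum_(i < n) ell (y i) (x i) + \sum_(i < n) ell (x (s i)) (y i)
     + 2 * D * (#|porbits s|)%:R.
Proof.
move=> D0 ellD.
move: {2}(#|porbits s|) (leqnn #|porbits s|) => m; elim: m s => [|m IHm] s sm.
  apply: le_trans (cyclic_tour x y (leq_trans sm _)) _ => //.
  have -> : #|porbits s| = 0%N by apply/eqP; rewrite -leqn0.
  by rewrite mulr0 addr0.
have [s1|s1] := leqP #|porbits s| 1.
  apply: le_trans (cyclic_tour x y s1) _; rewrite lerDl mulr_ge0//.
  exact: mulr_ge0.
have /card_gt1P[B1 [B2 [/imsetP[a _ ->] /imsetP[b _ ->] ab]]] := s1.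
have := porbits_mul_tperm s a b => /=.
rewrite -eq_porbit_mem ab.
have -> : a != b by apply: contraNneq ab => ->.
rewrite /= addn1 -addnn => /eqP; rewrite addnA !addn1 eqSS => /eqP cE.
have tm : (#|porbits (tperm a b * s)%g| <= m)%N by rewrite -ltnS cE.
apply: le_trans (IHm _ tm) _.
rewrite -cE -(natr1 #|porbits (tperm a b * s)%g|) mulrDr mulr1.
set A := \sum_(i < n) ell (y i) _; set N := #|_|%:R.
suff : \sum_(i < n) ell (x ((tperm a b * s)%g i)) (y i) <=
  \sum_(i < n) ell (x (s i)) (y i) + 2 * D by lra.
have nab : a != b by apply: contraNneq ab => ->.
rewrite (bigD1 a)//= (bigD1 b) 1?eq_sym//= [in leRHS](bigD1 a)//= [in leRHS](bigD1 b) 1?eq_sym//=.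
rewrite (eq_bigr (fun i => ell (x (s i)) (y i))); last first.
  by move=> i /andP[ia ib]; rewrite permM tpermD// eq_sym.
rewrite !permM tpermL tpermR.
have /andP[_ ?] := ellD (x (s b)) (y a).
have /andP[_ ?] := ellD (x (s a)) (y b).
have /andP[? _] := ellD (x (s b)) (y b).
have /andP[? _] := ellD (x (s a)) (y a).
set S := \sum_(i < n | _) _; lra.
Qed.

End Tours.

(** * Mean number of cycles of a uniform permutation *)

Section CycleCount.
Context (n : nat).
Implicit Types (s : {perm 'I_n}) (k : nat).

Let A k := [set s : {perm 'I_n} | perm_on [set i : 'I_n | (i < k)%N] s]%SET.

(** Precomposing a permutation of the first [k.+1] points with the transposition of [K] and its
    preimage [j] makes [K] fixed. The resulting bijection with pairs of some [j <= k] and a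
    permutation of the first [k] points drives the count. *)
Let A_step k (K j : 'I_n) s : K = k :> nat -> (j <= k)%N ->
  ((tperm K j * s)%g \in A k) = (s \in A k.+1) && (s j == K).
Proof.
move=> Kk jk; rewrite !inE /perm_on /=; apply/fintype.subsetP/andP => [H|[/fintype.subsetP H /eqP sj] i].
  have tK : s j = K.
    have [//|sjK] := eqVneq (s j) K.
    by have := H K; rewrite !inE permM tpermL Kk ltnn => /(_ sjK).
  split; last by rewrite tK.
  apply/fintype.subsetP => i; rewrite !inE ltnS => si.
  have [->//|ij] := eqVneq i j.
  have [->|iK] := eqVneq i K; first by rewrite Kk.
  have ti : tperm K j i = i by rewrite tpermD// eq_sym.
  by have := H i; rewrite !inE permM ti => /(_ si) /ltnW.
rewrite !inE permM; case: tpermP => [->|->|/eqP iK /eqP ij] si.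
- by rewrite sj eqxx in si.
- have jK : j != K by apply: contraNneq si => jK; rewrite -[in s _]jK sj jK.
  by rewrite ltn_neqAle jk andbT; apply: contraNneq jK => jk'; apply/eqP/val_inj; rewrite /= Kk.
- have := H i; rewrite !inE => /(_ si); rewrite ltnS leq_eqVlt => /predU1P[ik|//].
  by case/eqP: iK; apply: val_inj; rewrite /= Kk.
Qed.

(** [s] fixes [K], so the transposition absorbs the singleton cycle of [K] into the cycle of [j],
    unless [j] is [K]. *)
Let porbits_step k (K j : 'I_n) s : K = k :> nat -> s \in A k ->
  (#|porbits (tperm K j * s)%g| + (K != j) = #|porbits s|)%N.
Proof.
move=> Kk sA; have sK : s K = K.
  move: sA; rewrite inE => /fintype.subsetP/(_ K); rewrite !inE Kk ltnn.
  by case: eqVneq => // _ /(_ isT).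
have := porbits_mul_tperm s K j => /=.
have oK i : i \in porbit s K -> i = K.
  case/porbitP => m ->; elim: m => [|m IHm]; first by rewrite perm1.
  by rewrite expgSr permM IHm sK.
have -> : (K \notin porbit s j) = (K != j).
  congr (~~ _); rewrite porbit_sym; apply/idP/eqP => [/oK//|<-]; exact: porbit_id.
by case: (K != j); rewrite ?addn0//= => /eqP; rewrite !addn1 addn2 eqSS => /eqP.
Qed.

(** Among the [k + 1] choices of [j] all but one lose a cycle, so the mean count drops by
    [k / (k + 1)] from [A k] to [A k.+1]. Starting from [n] cycles at the identity it is
    [n - k + H k], the harmonic sum when [k = n]. *)
Lemma sum_porbits (R : realFieldType) :
  \sum_(s : {perm 'I_n}) #|porbits s|%:R = n`!%:R * \sum_(k < n) k.+1%:R^-1 :> R.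
Proof.
pose H k : R := \sum_(i < k) i.+1%:R^-1.
have claim k : (k <= n)%N ->
   (\sum_(s in A k) #|porbits s|%:R = k`!%:R * (n%:R - k%:R + H k) :> R) /\ #|A k| = k`!.
  elim: k => [|k IHk] kn.
    have -> : A 0%N = [set 1%g]%SET.
      apply/finset.setP => s; rewrite !inE; apply/idP/eqP => [/fintype.subsetP s0|->].
        apply/permP => i; rewrite perm1; apply/eqP/negP => si.
        by have := s0 i; rewrite !inE => /(_ (introN idP si)).
      by apply/fintype.subsetP => i; rewrite !inE perm1 eqxx.
    rewrite big_set1 cards1 /H big_ord0 addr0 subr0 mul1r; split => //; congr _%:R.
    rewrite -[RHS]card_ord /porbits card_imset//.
    move=> a b /finset.setP/(_ a); rewrite porbit_id => /esym/porbitP[m ->].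
    by rewrite expg1n perm1.
  have [IH1 IH2] := IHk (ltnW kn).
  pose K := Ordinal kn.
  have sumA (V : nmodType) (F : {perm 'I_n} -> V) : \sum_(s in A k.+1) F s =
      \sum_(j < n | (j <= k)%N) \sum_(s in A k) F (tperm K j * s)%g.
    rewrite (partition_big (fun s => (s^-1)%g K) (fun j : 'I_n => (j <= k)%N)) /=; last first.
      move=> s; rewrite inE => /fintype.subsetP sA; set j := (s^-1)%g K.
      have := sA j; rewrite !inE ltnS permKV; case: eqVneq => [<- _|_ ->//]; exact: leqnn.
    apply: eq_bigr => j jk; rewrite (reindex_inj (mulgI (tperm K j))) /=.
    apply: eq_bigl => s; have := A_step (tperm K j * s)%g (erefl : K = k :> nat) jk.
    rewrite mulgA tperm2 mul1g => ->; congr (_ && _).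
    by move: (tperm K j * s)%g => q; apply/eqP/eqP => <-; rewrite ?permK ?permKV.
  have ck : #|[pred j : 'I_n | (j <= k)%N]| = k.+1.
    have winj : injective (widen_ord kn) by move=> a b /(congr1 val)/= /val_inj.
    rewrite -[RHS]card_ord -(card_imset _ winj).
    apply: eq_card => j; rewrite !inE; apply/idP/imsetP => [jk|[i _ ->]].
      have jk' : (j < k.+1)%N by [].
      by exists (Ordinal jk') => //; apply: val_inj.
    by rewrite /= -ltnS ltn_ord.
  have cA : #|A k.+1| = k.+1`!.
    rewrite -sum1_card sumA; under eq_bigr do rewrite sum1_card IH2.
    by rewrite sum_nat_const ck factS.
  split => //.
  rewrite sumA.
  have E1 (j : 'I_n) : \sum_(s in A k) #|porbits (tperm K j * s)%g|%:R =
      \sum_(s in A k) #|porbits s|%:R - (K != j)%:R * k`!%:R :> R.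
    rewrite -IH2 mulr_natr -sumr_const -sumrB; apply: eq_bigr => s sA.
    by rewrite -(porbits_step j (erefl : K = k :> nat) sA) natrD addrK.
  under eq_bigr do rewrite E1 IH1.
  rewrite sumrB sumr_const ck -big_distrl /=.
  have -> : \sum_(i < n | (i <= k)%N) (K != i)%:R = k%:R :> R.
    rewrite (bigD1 K)//= eqxx add0r (eq_bigr (fun=> 1)); last first.
      by move=> i /andP[_ iK]; rewrite eq_sym iK.
    rewrite sumr_const; congr _%:R; apply: succn_inj.
    rewrite -[RHS]ck [RHS](cardD1 K) inE /= leqnn add1n; congr _.+1.
    by apply: eq_card => i; rewrite !inE andbC.
  rewrite factS natrM /H big_ord_recr /= -/(H k).
  rewrite -[_ *+ k.+1]mulr_natl -natr1.
  field.
  by rewrite natr1 pnatr_eq0.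
have [cl _] := claim n (leqnn n); move: cl; rewrite subrr add0r => <-.
apply: eq_bigl => s; rewrite inE; apply/esym/fintype.subsetP => i _.
by rewrite inE ltn_ord.
Qed.

End CycleCount.

(** * Duality for assignments *)

Section Potential.
Context (R : realType) (V : finType) (w : V -> V -> R).
Hypothesis w0 : forall i, w i i = 0.
Hypothesis w_perm : forall s : {perm V}, 0 <= \sum_i w i (s i).

Fixpoint path_weight (i : V) (p : seq V) : R :=
  if p is k :: q then w i k + path_weight k q else 0.

Let path_weight_cat i p q :
  path_weight i (p ++ q) = path_weight i p + path_weight (last i p) q.
Proof. by elim: p i => [|k p IHp] i /=; rewrite ?add0r// IHp addrA. Qed.

Let path_weight_nth a b p : path_weight a p + w (last a p) b =
  \sum_(0 <= k < (size p).+1) w (nth b (a :: p) k) (nth b p k).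
Proof.
elim: p a => [|k p IHp] a; first by rewrite big_nat1 add0r.
by rewrite big_nat_recl//= -addrA; congr (_ + _); exact: IHp.
Qed.

(** A simple cycle, completed by fixed points of weight zero, is a permutation. *)
Let cycle_ge0 a p : uniq (a :: p) -> 0 <= path_weight a p + w (last a p) a.
Proof.
set c := a :: p => uc.
have next_inj : injective (next c) by exact: can_inj (prev_next uc).
have := w_perm (perm next_inj); under eq_bigr do rewrite permE.
have -> : \sum_i w i (next c i) = \sum_(i in c) w i (next c i).
  rewrite [RHS]big_mkcond; apply: eq_bigr => i _; case: ifPn => // ic.
  by rewrite next_nth (negbTE ic) w0.
rewrite -big_uniq// (big_nth a) path_weight_nth => /le_trans; apply.
rewrite le_eqVlt; apply/orP; left; apply/eqP.
apply: eq_big_nat => k /andP[_ kc].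
by rewrite next_nth mem_nth// index_uniq.
Qed.

Lemma potential_exists : exists p : V -> R, forall i j, p j <= p i + w i j.
Proof.
pose S j : set R := [set r | exists a q, [/\ uniq (a :: q), last a q = j & r = path_weight a q]].
pose M := \sum_a \sum_b `|w a b|.
have wM a b : - M <= w a b.
  rewrite lerNl; apply: le_trans (ler_norm _) _; rewrite normrN /M.
  rewrite (bigD1 a)//= (bigD1 b)//= -addrA lerDl addr_ge0 ?sumr_ge0// => i _.
  by rewrite sumr_ge0.
have M0 : 0 <= M by apply: sumr_ge0 => i _; exact: sumr_ge0.
have S_lb j : has_inf (S j).
  split; first by exists 0, j, [::].
  exists (- (M *+ #|V|)) => r [a [q [u _ ->]]].
  have : (size (a :: q) <= #|V|)%N by rewrite -(card_uniqP u) max_card.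
  move=> /= /ltnW sq; apply: (@le_trans _ _ (- (M *+ size q))).
    by rewrite lerN2 ler_wpMn2l.
  elim: q a {u sq} => [|k q IHq] a /=; first by rewrite mulr0n oppr0.
  by rewrite mulrS opprD lerD.
exists (fun j => inf (S j)) => i j; rewrite -lerBlDr.
apply: lb_le_inf; first by have [] := S_lb i.
move=> _ [a [q [u qi ->]]]; rewrite lerBlDr.
suff [r Sr rle] : exists2 r, S j r & r <= path_weight a q + w i j.
  by apply: le_trans rle; apply: ge_inf => //; have [] := S_lb j.
have [jq|jq] := boolP (j \in a :: q); last first.
  exists (path_weight a q + w i j) => //; exists a, (rcons q j); split.
  - by rewrite -rcons_cons rcons_uniq jq.
  - by rewrite last_rcons.
  - by rewrite -cats1 path_weight_cat qi /= addr0.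
move: jq; rewrite inE => /predU1P[ja|jq].
  exists 0; first by exists j, [::].
  by rewrite ja -qi; exact: cycle_ge0.
case/splitPr: jq u qi => q1 q2 u qi.
exists (path_weight a (rcons q1 j)).
  exists a, (rcons q1 j); split => //; last by rewrite last_rcons.
  by move: u; rewrite -cat_cons -cat_rcons rcons_cons cat_uniq => /andP[].
rewrite -cat_rcons path_weight_cat last_rcons -addrA lerDl -qi last_cat /=.
apply: cycle_ge0; move: u; rewrite -cat_cons cat_uniq => /and3P[_ _ //].
Qed.

End Potential.

Section Duality.
Context (R : realType) (E : Type) (ell : E -> E -> R) (n : nat).
Hypothesis ell_triangle : forall u v t, ell u t <= ell u v + ell v t.
Hypothesis ell_ge0 : forall u v, 0 <= ell u v.
Hypothesis ell_diag : forall u, ell u u = 0.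

(* The potential is the lower envelope of the cones [ell u (y j) - p j] for
   the shortest-path potential [p] of the residual graph of an optimal
   assignment. *)
Lemma assign_duality (x y : 'I_n -> E) : exists g : E -> R,
  (forall u v, g u - g v <= ell u v) /\
  assign_min ell x y <= \sum_(i < n) (g (x i) - g (y i)).
Proof.
have [s sE] := minperm_ex (assign_len ell x y).
(* Extra cost when [i] takes the partner of [j]; optimality of [s] says that no permutation of
   partners is profitable. *)
pose w i j := ell (x i) (y (s j)) - ell (x i) (y (s i)).
have [|q|p pw] := @potential_exists R 'I_n w.
- by move=> i; rewrite /w subrr.
- rewrite /w sumrB subr_ge0.
  have := minperm_le (assign_len ell x y) (q * s)%g; rewrite sE.
  by rewrite /assign_len; under [X in _ <= X -> _]eq_bigr do rewrite permM.
have [n0|n0] := posnP n.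
  exists (fun=> 0); split => [u v|]; last first.
    rewrite /assign_min sE /assign_len !big1// => i;
    by case: i => i ilt; exfalso; rewrite n0 in ilt.
  by rewrite subrr.
pose i0 := Ordinal n0.
pose g u := \big[Num.min/ell u (y (s i0)) - p i0]_(j < n) (ell u (y (s j)) - p j).
have g_le u j : g u <= ell u (y (s j)) - p j by exact: bigmin_le.
have g_ge u a : (forall j, a <= ell u (y (s j)) - p j) -> a <= g u.
  by move=> h; apply: le_bigmin.
exists g; split => [u v|].
  rewrite lerBlDr -lerBlDl; apply: g_ge => j.
  by have := g_le u j; have := ell_triangle u v (y (s j)); lra.
rewrite /assign_min sE /assign_len sumrB.
rewrite [X in _ - X](reindex_inj (@perm_inj _ s))/= -sumrB; apply: ler_sum => i _.
have h1 : ell (x i) (y (s i)) - p i <= g (x i).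
  by apply: g_ge => j; have := pw i j; rewrite /w; lra.
by have := g_le (y (s i)) i; rewrite ell_diag; lra.
Qed.

End Duality.

(** * The urn flow *)

Lemma sum_triangle (V : nmodType) (f : nat -> nat -> V) (M : nat) :
  \sum_(t < M) \sum_(a < t.+1) f a (t - a)%N = \sum_(a < M) \sum_(b < M - a) f a b.
Proof.
elim: M => [|M IHM]; first by rewrite !big_ord0.
rewrite big_ord_recr /= IHM [RHS]big_ord_recr /= subSnn big_ord1.
rewrite [X in _ + X = _]big_ord_recr /= subnn addrA; congr (_ + _).
rewrite -big_split /=; apply: eq_bigr => a _.
by rewrite (subSn (ltnW (ltn_ord a))) big_ord_recr.
Qed.

Lemma sum_ord_trunc (V : nmodType) (F : nat -> V) (m n : nat) : (m <= n)%N ->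
  (forall i, (m <= i < n)%N -> F i = 0) -> \sum_(i < n) F i = \sum_(i < m) F i.
Proof.
move=> mn F0; rewrite -!(big_mkord predT) (big_cat_nat (leq0n _) mn)//=.
have -> : \sum_(m <= i < n) F i = 0; last by rewrite addr0.
by rewrite big_nat_cond big1// => i /andP[/F0].
Qed.

Lemma sum_ord_shift (V : nmodType) (F : nat -> V) (u n : nat) : (u <= n)%N ->
  \sum_(i < n) (if (u <= i)%N then F (i - u)%N else 0) = \sum_(i < n - u) F i.
Proof.
move=> un; rewrite -(big_mkord predT (fun i => if (u <= i)%N then F (i - u)%N else 0)).
rewrite -(big_mkord predT F) (big_cat_nat (leq0n _) un)//=.
have -> : \sum_(0 <= i < u) (if (u <= i)%N then F (i - u)%N else 0) = 0.
  by rewrite big_nat_cond big1// => i /andP[/andP[_ iu] _]; rewrite leqNgt iu.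
rewrite add0r.
rewrite -{1}[u]add0n big_addn; apply: eq_bigr => i _.
by rewrite leq_addl addnK.
Qed.

Section UrnFlow.
Context (R : realType).

(* Edge flows of the Polya urn walk started from one ball of each colour:
   after [t] steps it is uniform on the antidiagonal [a + b = t]. *)
Definition urn_x (a b : nat) : R := a.+1%:R / ((a + b).+1%:R * (a + b).+2%:R).
Definition urn_y (a b : nat) : R := b.+1%:R / ((a + b).+1%:R * (a + b).+2%:R).

Lemma urn_ge0 a b : 0 <= urn_x a b /\ 0 <= urn_y a b.
Proof. by split; rewrite divr_ge0// mulr_ge0. Qed.

Lemma urnD a b : urn_x a b + urn_y a b = (a + b).+1%:R^-1.
Proof.
rewrite /urn_x /urn_y -mulrDl -natrD addSn addnS -[X in X / _]mul1r.
by rewrite -mulf_div mulfV ?pnatr_eq0// mulr1 mul1r.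
Qed.

(** The node [(a, M.+1 - a)] receives [a] and [M.+1 - a] times [((M + 1) (M + 2))^-1] from its two
    predecessors, together [(M + 2)^-1]: the flow carries the uniform law of one antidiagonal to the
    next. *)
Lemma urn_step (G : nat -> nat -> R) (M : nat) :
  M.+1%:R^-1 * \sum_(a < M.+1) G a (M - a)%N +
  \sum_(a < M.+1) (urn_x a (M - a) * (G a.+1 (M - a)%N - G a (M - a)%N) +
                   urn_y a (M - a) * (G a (M - a).+1 - G a (M - a)%N)) =
  M.+2%:R^-1 * \sum_(a < M.+2) G a (M.+1 - a)%N.
Proof.
pose F a := G a (M.+1 - a)%N.
have M1 : M.+1%:R != 0 :> R by rewrite pnatr_eq0.
have M2 : M.+2%:R != 0 :> R by rewrite pnatr_eq0.
rewrite big_distrr /= -big_split /=.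
transitivity ((M.+1%:R * M.+2%:R)^-1 *
    (\sum_(a < M.+1) (a.+1%:R * F a.+1) + \sum_(a < M.+1) ((M.+1 - a)%N%:R * F a))).
  rewrite -big_split /= big_distrr /=; apply: eq_bigr => a _.
  have aM : (a <= M)%N by rewrite -ltnS.
  have E1 : urn_x a (M - a) = a.+1%:R / (M.+1%:R * M.+2%:R) by rewrite /urn_x subnKC.
  have E2 : urn_y a (M - a) = (M.+1 - a)%N%:R / (M.+1%:R * M.+2%:R).
    by rewrite /urn_y subnKC// subSn.
  have E3 := urnD a (M - a); rewrite subnKC// in E3.
  rewrite /F subSS -(subSn aM) -E3 E1 E2; ring.
have -> : \sum_(a < M.+1) (a.+1%:R * F a.+1) = \sum_(a < M.+2) (a%:R * F a).
  by rewrite [RHS]big_ord_recl mul0r add0r.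
have -> : \sum_(a < M.+1) ((M.+1 - a)%N%:R * F a) = \sum_(a < M.+2) ((M.+1 - a)%N%:R * F a).
  by rewrite [RHS]big_ord_recr /= subnn mul0r addr0.
rewrite -big_split /=.
have -> : \sum_(a < M.+2) (a%:R * F a + (M.+1 - a)%N%:R * F a) = M.+1%:R * \sum_(a < M.+2) F a.
  rewrite big_distrr /=; apply: eq_bigr => a _; rewrite -mulrDl -natrD subnKC//.
  by rewrite -ltnS.
by rewrite invfM mulrACA mulVf// mul1r.
Qed.

(** Summing [urn_step] telescopes from the value at the origin to the mean on the antidiagonal [M],
    where [G] vanishes. *)
Lemma urn_identity (G : nat -> nat -> R) (M : nat) :
  (forall a b, (M <= a + b)%N -> G a b = 0) ->
  G 0%N 0%N = - \sum_(a < M) \sum_(b < M - a)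
    (urn_x a b * (G a.+1 b - G a b) + urn_y a b * (G a b.+1 - G a b)).
Proof.
move=> G0.
pose f a b := urn_x a b * (G a.+1 b - G a b) + urn_y a b * (G a b.+1 - G a b).
have H N : G 0%N 0%N + \sum_(t < N) \sum_(a < t.+1) f a (t - a)%N =
    N.+1%:R^-1 * \sum_(a < N.+1) G a (N - a)%N.
  elim: N => [|N IHN]; first by rewrite big_ord0 addr0 invr1 mul1r big_ord1.
  by rewrite big_ord_recr /= addrA IHN urn_step.
have := H M; rewrite sum_triangle [X in _ = _ * X]big1 ?mulr0; last first.
  by move=> a _; rewrite G0// subnKC// -ltnS.
by move/eqP; rewrite addr_eq0 => /eqP.
Qed.

(** The kernel [k] translated to start at [u]. The tests precede the truncated subtractions, which
    would otherwise put spurious values outside the quadrant. *)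
Definition flow (k : nat -> nat -> R) (u z : nat * nat) : R :=
  if (u.1 <= z.1)%N then if (u.2 <= z.2)%N then k (z.1 - u.1)%N (z.2 - u.2)%N else 0 else 0.

Lemma flowE (k F : nat -> nat -> R) (u : nat * nat) (S : nat) :
  (u.1 <= S)%N -> (u.2 <= S)%N ->
  \sum_(i < S) \sum_(j < S) flow k u (nat_of_ord i, nat_of_ord j) * F i j =
  \sum_(a < S - u.1) \sum_(b < S - u.2) k a b * F (u.1 + a)%N (u.2 + b)%N.
Proof.
move=> u1 u2; rewrite -(sum_ord_shift (fun a => \sum_(b < S - u.2) k a b * F (u.1 + a)%N (u.2 + b)%N) u1).
apply: eq_bigr => i _.
rewrite /flow /=; case: ifPn => [ui|_]; last by rewrite big1// => j _; rewrite mul0r.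
rewrite -(sum_ord_shift (fun b => k (i - u.1)%N b * F (u.1 + (i - u.1))%N (u.2 + b)%N) u2).
apply: eq_bigr => j _.
case: ifPn => [uj|_]; last by rewrite mul0r.
by rewrite !subnKC.
Qed.

(** The triangle of [urn_identity] and the square shifted by [u] can both be exchanged for one
    square, because the increments of [g] vanish from the antidiagonal [S] on. *)
Lemma flow_identity (g : nat -> nat -> R) (u : nat * nat) (S : nat) :
  (u.1 <= S)%N -> (u.2 <= S)%N ->
  (forall a b, (S <= a + b)%N -> g a b = 0) ->
  g u.1 u.2 = - \sum_(i < S) \sum_(j < S)
    (flow urn_x u (nat_of_ord i, nat_of_ord j) * (g i.+1 j - g i j) +
     flow urn_y u (nat_of_ord i, nat_of_ord j) * (g i j.+1 - g i j)).
Proof.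
move=> u1 u2 g0; pose G a b := g (u.1 + a)%N (u.2 + b)%N.
have G0 a b : (S <= a + b)%N -> G a b = 0.
  by move=> Sab; rewrite /G g0// addnACA (leq_trans Sab)// leq_addl.
have := urn_identity G0; rewrite {1}/G !addn0 => ->; congr (- _).
under [RHS]eq_bigr do rewrite big_split /=.
rewrite big_split /= (flowE _ (fun i j => g i.+1 j - g i j))//.
rewrite (flowE _ (fun i j => g i j.+1 - g i j))// -big_split /=.
under [RHS]eq_bigr do rewrite -big_split /=.
pose f a b := urn_x a b * (G a.+1 b - G a b) + urn_y a b * (G a b.+1 - G a b).
have f0 a b : (S <= u.1 + a + (u.2 + b))%N -> f a b = 0.
  move=> h; rewrite /f /G !addnS !g0 ?subrr ?mulr0 ?addr0// ?addSn ?addnS//;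
  exact: leq_trans h (leqnSn _).
transitivity (\sum_(a < S) \sum_(b < S) f a b).
  apply: eq_bigr => a _; rewrite -/(f _ _) [RHS](@sum_ord_trunc _ (f a) (S - a))//.
    exact: leq_subr.
  move=> b /andP[Sab _]; apply: f0; rewrite addnACA (leq_trans _ (leq_addl _ _))//.
  by rewrite -leq_subLR.
rewrite (@sum_ord_trunc _ (fun a => \sum_(b < S) f a b) (S - u.1)) ?leq_subr//; last first.
  move=> a /andP[Sa _]; rewrite big1// => b _; apply: f0.
  by rewrite (leq_trans _ (leq_addr _ _))// -leq_subLR.
apply: eq_bigr => a _; rewrite (@sum_ord_trunc _ (f a) (S - u.2)) ?leq_subr//; last first.
  move=> b /andP[Sb _]; apply: f0.
  by rewrite (leq_trans _ (leq_addl _ _))// -leq_subLR.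
by apply: eq_bigr => b _; rewrite /f /G !addnS.
Qed.

(** On the antidiagonal [t] the outflow of each of the [t + 1] nodes is [1 / (t + 1)], so the
    squares add up to at most [1 / (t + 1)]. The square of side [S] lies within the first [S + S]
    antidiagonals. *)
Lemma flow_energy (u : nat * nat) (S : nat) : (u.1 <= S)%N -> (u.2 <= S)%N ->
  \sum_(i < S) \sum_(j < S) (flow urn_x u (nat_of_ord i, nat_of_ord j) ^+ 2 +
     flow urn_y u (nat_of_ord i, nat_of_ord j) ^+ 2) <=
  \sum_(t < S + S) t.+1%:R^-1.
Proof.
move=> u1 u2.
pose e a b := urn_x a b ^+ 2 + urn_y a b ^+ 2.
have e0 a b : 0 <= e a b by rewrite addr_ge0 ?sqr_ge0.
have flow2 i j : flow urn_x u (i, j) ^+ 2 + flow urn_y u (i, j) ^+ 2 = flow e u (i, j) * 1.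
  rewrite /flow /= mulr1; case: (_ <= _)%N; last by rewrite expr0n addr0.
  by case: (_ <= _)%N => //; rewrite expr0n addr0.
under eq_bigr do under eq_bigr do rewrite flow2.
rewrite (flowE _ (fun _ _ => 1))//.
apply: (@le_trans _ _ (\sum_(a < S + S) \sum_(b < S + S - a) e a b)).
  apply: (@le_trans _ _ (\sum_(a < S - u.1) \sum_(b < S + S - a) e a b)).
    apply: ler_sum => a _; under eq_bigr do rewrite mulr1.
    have h : (S - u.2 <= S + S - a)%N.
      rewrite (leq_trans (leq_subr _ _))// -addnBA ?leq_addr//.
      by rewrite ltnW// (leq_trans (ltn_ord a))// leq_subr.
    by rewrite -!(big_mkord predT (e a)) [leRHS](big_cat_nat (leq0n _) h)//= lerDl sumr_ge0.
  have h : (S - u.1 <= S + S)%N by rewrite (leq_trans (leq_subr _ _))// leq_addr.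
  rewrite -!(big_mkord predT (fun a => \sum_(b < S + S - a) e a b)).
  rewrite [leRHS](big_cat_nat (leq0n _) h)//= lerDl sumr_ge0// => a _.
  by rewrite sumr_ge0.
rewrite -sum_triangle; apply: ler_sum => t _.
apply: (@le_trans _ _ (\sum_(a < t.+1) t.+1%:R^-1 ^+ 2)).
  apply: ler_sum => a _; have ta : (a <= t)%N by rewrite -ltnS.
  have := urnD a (t - a); rewrite subnKC// => <-.
  have [x0 y0] := urn_ge0 a (t - a).
  by rewrite /e sqrrD lerD2r lerDl mulrn_wge0// mulr_ge0.
by rewrite sumr_const card_ord -[_ *+ _]mulr_natl expr2 mulrA mulfV ?mul1r// pnatr_eq0.
Qed.

End UrnFlow.

Lemma clamp_lipschitz (R : realDomainType) (a a' b b' : R) :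
  `|a - a'| <= 1 -> `|b - b'| <= 1 ->
  `|Num.max 0 (Num.min a b) - Num.max 0 (Num.min a' b')| <= 1.
Proof.
rewrite !ler_norml => /andP[? ?] /andP[? ?].
rewrite /Num.max /Num.min; case: (ltP a b) => ?; case: (ltP a' b') => ?;
  by do 2 (case: (ltP 0 _) => ?); apply/andP; split; lra.
Qed.

Section FlowBound.
Context (R : realType) (n : nat).

(* The potential is lowered to [0] along the antidiagonal [a + b = 6 N], beyond
   which the flow identity needs no boundary term. *)
Lemma flow_bound (N : nat) (u v : 'I_n -> nat * nat) (g : nat -> nat -> R) :
  (forall a b, `|g a.+1 b - g a b| <= 1) -> (forall a b, `|g a b.+1 - g a b| <= 1) ->
  (forall k, ((u k).1 <= N) && ((u k).2 <= N))%N ->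
  (forall k, ((v k).1 <= N) && ((v k).2 <= N))%N ->
  \sum_(k < n) (g (u k).1 (u k).2 - g (v k).1 (v k).2) <=
  \sum_(i < 6 * N) \sum_(j < 6 * N)
    (`|\sum_(k < n) (flow (@urn_x R) (u k) (nat_of_ord i, nat_of_ord j)
                      - flow (@urn_x R) (v k) (nat_of_ord i, nat_of_ord j))| +
     `|\sum_(k < n) (flow (@urn_y R) (u k) (nat_of_ord i, nat_of_ord j)
                      - flow (@urn_y R) (v k) (nat_of_ord i, nat_of_ord j))|).
Proof.
move=> gx gy uN vN; set S := (6 * N)%N.
have g_dist a b : `|g a b - g 0%N 0%N| <= (a + b)%:R.
  have g0 : `|g 0%N b - g 0%N 0%N| <= b%:R.
    elim: b => [|b IHb]; first by rewrite subrr normr0.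
    rewrite (_ : _ - _ = (g 0%N b.+1 - g 0%N b) + (g 0%N b - g 0%N 0%N)); last by ring.
    by rewrite (le_trans (ler_normD _ _))// -natr1 addrC lerD.
  elim: a => [//|a IHa].
  rewrite (_ : _ - _ = (g a.+1 b - g a b) + (g a b - g 0%N 0%N)); last by ring.
  by rewrite (le_trans (ler_normD _ _))// addSn -natr1 addrC lerD.
(* On the square of side [N] the potential differs from its value at the origin by at most [2 N], so
   [g - m] stays in [[0, 4 N]] there, while [6 N - (a + b)] is at least [4 N]: the clamp changes
   nothing at the sample points. This fixes the factor [6]. *)
pose m := g 0%N 0%N - (2 * N)%:R.
pose h a b := Num.max 0 (Num.min (g a b - m) (S%:R - (a + b)%:R)).
have h0 a b : (S <= a + b)%N -> h a b = 0.
  move=> Sab; rewrite /h; apply/max_idPl; rewrite ge_min; apply/orP; right.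
  by rewrite subr_le0 ler_nat.
have hE a b : (a <= N)%N -> (b <= N)%N -> h a b = g a b - m.
  move=> aN bN; have := g_dist a b; rewrite ler_norml => /andP[g1 g2].
  have abN : (a + b)%:R <= (2 * N)%:R :> R by rewrite ler_nat mul2n -addnn leq_add.
  rewrite /h min_l.
    by apply/max_idPr; rewrite /m; lra.
  by rewrite /m /S !natrM in abN *; lra.
have sub3 (x y z : R) : x - z - (y - z) = x - y by ring.
have sub4 (x y : R) : x - (y + 1) - (x - y) = - 1 by ring.
have hx a b : `|h a.+1 b - h a b| <= 1.
  apply: clamp_lipschitz; first by rewrite sub3.
  by rewrite addSn -natr1 sub4 normrN1.
have hy a b : `|h a b.+1 - h a b| <= 1.
  apply: clamp_lipschitz; first by rewrite sub3.
  by rewrite addnS -natr1 sub4 normrN1.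
have NS : (N <= S)%N by rewrite /S leq_pmull.
have leS (a : nat) : (a <= N)%N -> (a <= S)%N by move=> /leq_trans; apply.
have E1 (w : nat * nat) : ((w.1 <= N) && (w.2 <= N))%N -> g w.1 w.2 = m + h w.1 w.2.
  by move=> /andP[w1 w2]; rewrite hE// addrC subrK.
have hI (w : nat * nat) (wN : ((w.1 <= N) && (w.2 <= N))%N) :
    h w.1 w.2 = _ := flow_identity (leS _ (proj1 (andP wN))) (leS _ (proj2 (andP wN))) h0.
pose fx w i j := flow (@urn_x R) w (i, j).
pose fy w i j := flow (@urn_y R) w (i, j).
have -> : \sum_(k < n) (g (u k).1 (u k).2 - g (v k).1 (v k).2) =
  - \sum_(i < S) \sum_(j < S)
    ((\sum_(k < n) (fx (u k) i j - fx (v k) i j)) * (h i.+1 j - h i j) +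
     (\sum_(k < n) (fy (u k) i j - fy (v k) i j)) * (h i j.+1 - h i j)).
  under eq_bigr => k _ do rewrite !E1// !hI//.
  have -> : \sum_(k < n) (m - \sum_(i < S) \sum_(j < S)
       (fx (u k) i j * (h i.+1 j - h i j) + fy (u k) i j * (h i j.+1 - h i j)) -
      (m - \sum_(i < S) \sum_(j < S)
       (fx (v k) i j * (h i.+1 j - h i j) + fy (v k) i j * (h i j.+1 - h i j)))) =
     - \sum_(k < n) \sum_(i < S) \sum_(j < S)
       ((fx (u k) i j - fx (v k) i j) * (h i.+1 j - h i j) +
        (fy (u k) i j - fy (v k) i j) * (h i j.+1 - h i j)).
    rewrite -sumrN; apply: eq_bigr => k _.
    rewrite opprD addrACA subrr add0r -opprD; congr (- _).
    rewrite -sumrB; apply: eq_bigr => i _; rewrite -sumrB; apply: eq_bigr => j _; ring.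
  congr (- _); rewrite exchange_big; apply: eq_bigr => i _.
  rewrite exchange_big; apply: eq_bigr => j _.
  by rewrite big_split /= -!big_distrl.
rewrite -sumrN; apply: ler_sum => i _; rewrite -sumrN; apply: ler_sum => j _.
rewrite opprD; apply: lerD; apply: le_trans (ler_norm _) _; rewrite normrN normrM;
  by rewrite ler_piMr.
Qed.

End FlowBound.

(** * Second moments of sums of independent symmetric differences *)

Section SymmetricSums.
Context (R : realType) dE (E : measurableType dE) (n : nat).
Context d (T : measurableType d) (P : probability T R) (Z : bool * 'I_n -> T -> E).
Hypothesis iZ : indep P Z.
Hypothesis eqZ : forall i j, law_eq P P (Z i) (Z j).

Let bZ (phi : E -> R) (j : bool * 'I_n) : bmeas phi -> bmeas (fun w => phi (Z j w)).
Proof. by move=> bphi; apply: (@bmeas_comp _ _ _ _ _ (Z j)) => //; case: iZ. Qed.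

(* Exchanging the two variables of index [k] flips the sign of the product. *)
Lemma E_cross_diff (phi : E -> R) (k l : 'I_n) : bmeas phi -> k != l ->
  \int[P]_w ((phi (Z (false, k) w) - phi (Z (true, k) w)) *
             (phi (Z (false, l) w) - phi (Z (true, l) w))) = 0.
Proof.
move=> bphi kl.
pose h (bi : bool * 'I_n) := (if bi.2 == k then ~~ bi.1 else bi.1, bi.2).
have hinj : injective h.
  move=> [b i] [b' i'] [] /[swap] <-.
  by case: (i == k) => [/(can_inj negbK)|] ->.
have iZh := indep_inj hinj iZ.
pose f (z : conf E (bool * 'I_n)%type) := (phi (z (false, k)) - phi (z (true, k))) *
             (phi (z (false, l)) - phi (z (true, l))).
have bc j : bmeas (fun z : conf E (bool * 'I_n)%type => phi (z j)).
  exact: (bmeas_comp (measurable_coord j) bphi).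
have bf : bmeas f by apply: bmeasM; apply: bmeasB.
have E1 := indep_Rintegral_eq iZ iZh (fun j => eqZ j (h j)) bf.
have : \int[P]_w f (fun j => Z j w) = - \int[P]_w f (fun j => Z j w).
  rewrite {1}E1 -[RHS]mulN1r -bmeas_RintegralZl; last by apply: (bmeas_comp (measurable_family iZ) bf).
  apply: eq_Rintegral => w _; rewrite /f /h /= eqxx eq_sym (negbTE kl) /=.
  by rewrite mulN1r -mulNr opprB.
rewrite /f; lra.
Qed.

Lemma E_sum_diff_sq (phi : E -> R) : bmeas phi ->
  \int[P]_w ((\sum_(k < n) (phi (Z (false, k) w) - phi (Z (true, k) w))) ^+ 2) <=
  \sum_(k < n) (2 * \int[P]_w (phi (Z (false, k) w) ^+ 2) + 2 * \int[P]_w (phi (Z (true, k) w) ^+ 2)).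
Proof.
move=> bphi; pose xi k w := phi (Z (false, k) w) - phi (Z (true, k) w).
have bxi k : bmeas (xi k) by apply: bmeasB; exact: bZ.
have bsq j : bmeas (fun w => phi (Z j w) ^+ 2).
  by under eq_fun do rewrite expr2; apply: bmeasM; exact: bZ.
under eq_Rintegral do rewrite expr2 big_distrlr /=.
rewrite bmeas_Rintegral_sum; last first.
  by move=> k; apply: bmeas_sum => l; apply: bmeasM; exact: bxi.
apply: ler_sum => k _; rewrite bmeas_Rintegral_sum; last by move=> l; apply: bmeasM; exact: bxi.
rewrite (bigD1 k)//= big1 ?addr0; last first.
  by move=> l lk; apply: E_cross_diff; rewrite 1?eq_sym.
rewrite -!bmeas_RintegralZl// -bmeas_RintegralD; [|exact: bmeasZ|exact: bmeasZ].
apply: le_bmeas_Rintegral; [by apply: bmeasM; exact: bxi|by apply: bmeasD; exact: bmeasZ|].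
move=> w; set a := phi _; set b := phi _.
have := sqr_ge0 (a + b); nra.
Qed.

(** Each edge is treated by [|t| <= la / 2 + t^2 / (2 la)], Cauchy-Schwarz with a weight to be
    chosen later. The first term counts the edges, two per node; the second is the energy, to which
    each of the [2 n] points contributes a harmonic sum. *)
Lemma E_flow_bound (N : nat) (q : E -> nat * nat) (la : R) : 0 < la ->
  (forall x, ((q x).1 <= N) && ((q x).2 <= N))%N ->
  (forall k z, bmeas (fun x => flow k (q x) z : R)) ->
  \int[P]_w (\sum_(i < 6 * N) \sum_(j < 6 * N)
    (`|\sum_(k < n) (flow (@urn_x R) (q (Z (false, k) w)) (nat_of_ord i, nat_of_ord j)
                      - flow (@urn_x R) (q (Z (true, k) w)) (nat_of_ord i, nat_of_ord j))| +
     `|\sum_(k < n) (flow (@urn_y R) (q (Z (false, k) w)) (nat_of_ord i, nat_of_ord j)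
                      - flow (@urn_y R) (q (Z (true, k) w)) (nat_of_ord i, nat_of_ord j))|))
  <= la * (6 * N)%:R ^+ 2 + 2 * n%:R / la * \sum_(t < 6 * N + 6 * N) t.+1%:R^-1.
Proof.
move=> la0 qN bq; set S := (6 * N)%N.
pose D k z w := \sum_(l < n) (flow k (q (Z (false, l) w)) z - flow k (q (Z (true, l) w)) z) : R.
have bfl k z j : bmeas (fun w => flow k (q (Z j w)) z : R) by exact: (bZ j (bq k z)).
have bD k z : bmeas (D k z) by apply: bmeas_sum => l; apply: bmeasB.
have bD2 k z : bmeas (fun w => D k z w ^+ 2).
  by under eq_fun do rewrite expr2; exact: bmeasM.
have bf2 k z j : bmeas (fun w => flow k (q (Z j w)) z ^+ 2 : R).
  by under eq_fun do rewrite expr2; exact: bmeasM.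
have absD k z : \int[P]_w `|D k z w| <= la / 2 + (2 * la)^-1 * \int[P]_w (D k z w ^+ 2).
  rewrite -(probability_Rintegral_cst P (la / 2)) -bmeas_RintegralZl// -bmeas_RintegralD; [|exact: bmeas_cst|exact: bmeasZ].
  apply: le_bmeas_Rintegral; [exact: bmeas_norm|by apply: bmeasD; [exact: bmeas_cst|exact: bmeasZ]|].
  move=> w; set t := D k z w.
  rewrite -(ler_pM2l (mulr_gt0 (ltr0n _ 2) la0)) mulrDr mulVKf; last first.
    by rewrite mulf_neq0// gt_eqF.
  have := sqr_ge0 (`|t| - la); rewrite -(real_normK (num_real t)); nra.
rewrite bmeas_Rintegral_sum; last first.
  by move=> i; apply: bmeas_sum => j; apply: bmeasD; apply: bmeas_norm; exact: bD.
pose Z2 (i j : nat) b l := \int[P]_w (flow (@urn_x R) (q (Z (b, l) w)) (i, j) ^+ 2 +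
       flow (@urn_y R) (q (Z (b, l) w)) (i, j) ^+ 2).
apply: (@le_trans _ _ (\sum_(i < S) \sum_(j < S) (la +
    la^-1 * \sum_(l < n) (Z2 i j false l + Z2 i j true l)))).
  apply: ler_sum => i _; rewrite bmeas_Rintegral_sum; last first.
    by move=> j; apply: bmeasD; apply: bmeas_norm; exact: bD.
  apply: ler_sum => j _; rewrite bmeas_RintegralD; [|apply: bmeas_norm; exact: bD..].
  pose z := (nat_of_ord i, nat_of_ord j).
  have hx := le_trans (absD (@urn_x R) z) (lerD (lexx _) (ler_wpM2l _ (E_sum_diff_sq (bq _ z)))).
  have hy := le_trans (absD (@urn_y R) z) (lerD (lexx _) (ler_wpM2l _ (E_sum_diff_sq (bq _ z)))).
  have l0 : 0 <= (2 * la)^-1 by rewrite invr_ge0 mulr_ge0// ltW.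
  apply: le_trans (lerD (hx l0) (hy l0)) _; rewrite addrACA -splitr lerD2l -mulrDr -big_split /=.
  rewrite invfM -mulrA mulrCA ler_pM2l ?invr_gt0// big_distrr /= le_eqVlt; apply/orP; left; apply/eqP.
  by apply: eq_bigr => l _; rewrite /Z2 !bmeas_RintegralD//; field.
under eq_bigr do rewrite big_split /= sumr_const card_ord.
have laS : la *+ S *+ S = la * S%:R ^+ 2 by rewrite expr2 mulrA !mulr_natr.
rewrite big_split /= sumr_const card_ord laS lerD2l.
under eq_bigr do rewrite -big_distrr /=.
rewrite -big_distrr /= [2 * n%:R / la]mulrC -[leRHS]mulrA ler_pM2l ?invr_gt0//.
have enl b l : \sum_(i < S) \sum_(j < S) Z2 i j b l <= \sum_(t < S + S) t.+1%:R^-1.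
  rewrite /Z2 -(probability_Rintegral_cst P (\sum_(t < S + S) t.+1%:R^-1)).
  rewrite (eq_bigr (fun i : 'I_S => \int[P]_w (\sum_(j < S)
      (flow (@urn_x R) (q (Z (b, l) w)) (nat_of_ord i, nat_of_ord j) ^+ 2 +
       flow (@urn_y R) (q (Z (b, l) w)) (nat_of_ord i, nat_of_ord j) ^+ 2)))); last first.
    by move=> i _; rewrite bmeas_Rintegral_sum// => j; apply: bmeasD.
  rewrite -bmeas_Rintegral_sum; last by move=> i; apply: bmeas_sum => j; apply: bmeasD.
  apply: le_bmeas_Rintegral; [by apply: bmeas_sum => i; apply: bmeas_sum => j; apply: bmeasD|exact: bmeas_cst|].
  have NS : (N <= S)%N by rewrite /S leq_pmull.
  by move=> w; have /andP[q1 q2] := qN (Z (b, l) w); apply: flow_energy; exact: leq_trans NS.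
under eq_bigr do rewrite exchange_big /=.
rewrite exchange_big /=.
apply: (@le_trans _ _ (\sum_(l < n) (2 * \sum_(t < S + S) t.+1%:R^-1))).
  apply: ler_sum => l _; under eq_bigr do rewrite big_split /=.
  by rewrite big_split /= mulr_natl mulr2n lerD.
by rewrite sumr_const card_ord -[leLHS]mulr_natr mulrAC.
Qed.

End SymmetricSums.

(** * Mean lengths of tours and assignments *)

Lemma minperm_lipschitz (R : realType) (n : nat) (c c' : {perm 'I_n} -> R) (e : R) :
  (forall s, `|c s - c' s| <= e) -> `|minperm c - minperm c'| <= e.
Proof.
move=> cc'; have [s sE] := minperm_ex c; have [s' s'E] := minperm_ex c'.
have := minperm_le c s'; have := minperm_le c' s; rewrite sE s'E => h1 h2.
have := cc' s; have := cc' s'; rewrite !ler_norml => /andP[? ?] /andP[? ?].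
by apply/andP; split; lra.
Qed.

Lemma sum_diff1 (R : realType) (n : nat) (F F' : 'I_n -> R) (k0 : 'I_n) (e : R) :
  0 <= e -> (forall k, k != k0 -> F k = F' k) -> `|F k0 - F' k0| <= e ->
  `|\sum_k F k - \sum_k F' k| <= e.
Proof.
move=> e0 FF' Fe; rewrite -sumrB (bigD1 k0)//= big1 ?addr0// => k kk0.
by rewrite FF'// subrr.
Qed.

Section MeanBounds.
Context (R : realType) dE (E : measurableType dE) (ell : E -> E -> R) (D : R).
Hypothesis D0 : 0 <= D.
Hypothesis bell : bmeas (fun p : E * E => ell p.1 p.2).
Hypothesis ell_bd : forall u v, 0 <= ell u v <= D.
Hypothesis ell_sym : forall u v, ell u v = ell v u.
Hypothesis ell_triangle : forall u v t, ell u t <= ell u v + ell v t.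

Lemma assign_min_sym n (x y : 'I_n -> E) : assign_min ell x y = assign_min ell y x.
Proof.
suff H (a b : 'I_n -> E) : assign_min ell a b <= assign_min ell b a.
  by apply/eqP; rewrite eq_le !H.
have [s sE] := minperm_ex (assign_len ell b a); rewrite {2}/assign_min sE.
apply: le_trans (minperm_le _ s^-1%g) _; rewrite le_eqVlt; apply/orP; left; apply/eqP.
rewrite /assign_len (reindex_inj (@perm_inj _ s)); apply: eq_bigr => i _.
by rewrite permK ell_sym.
Qed.

(** The flag [true] marks pickups and [false] deliveries. [assign_conf] links deliveries to pickups,
    in the direction of the empty legs. *)
Definition tour_conf n (z : bool * 'I_n -> E) : R :=
  tour_min ell (fun i => z (true, i)) (fun i => z (false, i)).

Definition assign_conf n (z : bool * 'I_n -> E) : R :=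
  assign_min ell (fun i => z (false, i)) (fun i => z (true, i)).

Section Regularity.
Variable n : nat.
Let C := conf E (bool * 'I_n)%type.

Let bmeas_ell (i j : bool * 'I_n) : bmeas (fun z : C => ell (z i) (z j)).
Proof.
apply: (@bmeas_comp _ _ _ _ _ (fun z : C => (z i, z j)) _ _ bell).
by apply: measurable_fun_pair; exact: measurable_coord.
Qed.

Lemma bmeas_tour_conf : bmeas (@tour_conf n : C -> R).
Proof.
have b s : bmeas (fun z : C => tour_len ell (fun i => z (true, i)) (fun i => z (false, i)) s).
  by apply: bmeas_sum => k; apply: bmeasD; exact: bmeas_ell.
exact: (bmeas_bigmin _ (b 1%g) b).
Qed.

Lemma bmeas_assign_conf : bmeas (@assign_conf n : C -> R).
Proof.
have b s : bmeas (fun z : C => assign_len ell (fun i => z (false, i)) (fun i => z (true, i)) s).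
  by apply: bmeas_sum => k; exact: bmeas_ell.
exact: (bmeas_bigmin _ (b 1%g) b).
Qed.

Let ell_diff u v u' v' : `|ell u v - ell u' v'| <= D.
Proof.
have /andP[? ?] := ell_bd u v; have /andP[? ?] := ell_bd u' v'.
by rewrite ler_norml; apply/andP; split; lra.
Qed.

(** A point belongs to one link, which gives [D]; the constant is that of [tour_conf_diff], where a
    point has a loaded and an empty leg. *)
Lemma assign_conf_diff (z : C) j u : `|assign_conf (upd z j u) - assign_conf z| <= 2 * D.
Proof.
apply: minperm_lipschitz => s; apply: (@le_trans _ _ D); last by rewrite ler_peMl// ler1n.
case: j => -[] i; last first.
  apply: (@sum_diff1 _ _ _ _ i) => // k ki.
  by rewrite /upd !xpair_eqE /= (negbTE ki).
apply: (@sum_diff1 _ _ _ _ (s^-1%g i)) => // k ki.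
rewrite /upd !xpair_eqE /= -(inj_eq (@perm_inj _ s^-1%g)) permK.
by rewrite (negbTE ki).
Qed.

Lemma tour_conf_diff (z : C) j u : `|tour_conf (upd z j u) - tour_conf z| <= 2 * D.
Proof.
apply: minperm_lipschitz => s; rewrite /tour_len !big_split /= opprD addrACA.
rewrite (le_trans (ler_normD _ _))// mulr_natl mulr2n.
have si k i : (s k == i) = (k == s^-1%g i).
  by rewrite -(inj_eq (@perm_inj _ s^-1%g)) permK.
case: j => b i; apply: lerD.
  apply: (@sum_diff1 _ _ _ _ (s^-1%g i)) => // k ki.
  by rewrite /upd !xpair_eqE si (negbTE ki) !andbF.
case: b.
  (* A pickup ends the empty leg of the preceding position, whence [ord_pred]. *)
  have [k0 k0E] : exists k0, forall k, (s (ordS k) == i) = (k == k0).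
    exists (ord_pred (s^-1%g i)) => k; rewrite si.
    by apply/eqP/eqP => [<-|->]; rewrite ?ordSK ?ord_predK.
  apply: (@sum_diff1 _ _ _ _ k0) => // k kk0.
  by rewrite /upd !xpair_eqE /= k0E (negbTE kk0).
apply: (@sum_diff1 _ _ _ _ (s^-1%g i)) => // k ki.
by rewrite /upd !xpair_eqE /= si (negbTE ki).
Qed.

Lemma assign_conf_lipschitz (z : C) (k : 'I_n) u v :
  assign_conf (upd z (false, k) u) <= assign_conf (upd z (false, k) v) + ell u v.
Proof.
rewrite /assign_conf {2}/assign_min.
have [s ->] := minperm_ex (assign_len ell (fun i => upd z (false, k) v (false, i))
  (fun i => upd z (false, k) v (true, i))).
apply: le_trans (minperm_le _ s) _; rewrite /assign_len.
rewrite (bigD1 k)//= [in leRHS](bigD1 k)//= /upd !xpair_eqE !eqxx /=.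
rewrite (eq_bigr (fun i => ell (z (false, i)) (z (true, s i)))); last first.
  by move=> i ik; rewrite !xpair_eqE (negbTE ik).
rewrite [in leRHS](eq_bigr (fun i => ell (z (false, i)) (z (true, s i)))); last first.
  by move=> i ik; rewrite !xpair_eqE (negbTE ik).
rewrite addrAC lerD2r addrC; exact: ell_triangle.
Qed.

End Regularity.

(* Averaging over all relabellings of the deliveries makes the permutation of
   an optimal assignment uniform, so that it has few cycles on average. *)
Lemma sum_tour_conf_le n (z : bool * 'I_n -> E) :
  \sum_(q : {perm 'I_n}) tour_conf (fun bi => z (bi.1, if bi.1 then bi.2 else q bi.2)) <=
  \sum_(q : {perm 'I_n}) \sum_(i < n) ell (z (false, q i)) (z (true, i)) +
  n`!%:R * (assign_conf z + 2 * D * \sum_(k < n) k.+1%:R^-1).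
Proof.
have [s sE] := minperm_ex (assign_len ell (fun i => z (false, i)) (fun i => z (true, i))).
apply: (@le_trans _ _ (\sum_(q : {perm 'I_n}) (\sum_(i < n) ell (z (false, q i)) (z (true, i)) +
   assign_conf z + 2 * D * #|porbits (q * s)%g|%:R))).
  apply: ler_sum => q _.
  apply: le_trans (tour_le_cycles _ _ (q * s)%g D0 ell_bd) _.
  rewrite lerD2r lerD2l /= /assign_conf /assign_min sE /assign_len.
  rewrite [leRHS](reindex_inj (@perm_inj _ q)) /= le_eqVlt; apply/orP; left; apply/eqP.
  by apply: eq_bigr => i _; rewrite permM ell_sym.
rewrite !big_split /= -addrA lerD2l mulrDr lerD//.
  by rewrite sumr_const mulr_natl [X in _ *+ X]card_Sn.
have := sum_porbits n R; rewrite (reindex_inj (mulIg s)) /= => hq.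
by rewrite -big_distrr /= hq mulrCA.
Qed.

Section Means.
Context d (T : measurableType d) (P : probability T R) (W : bool * nat -> T -> E).
Hypothesis iW : indep P W.
Hypothesis eqW : forall b i j, law_eq P P (W (b, i)) (W (b, j)).

Lemma E_ell_pair i j :
  \int[P]_w ell (W (false, i) w) (W (true, j) w) =
  \int[P]_w ell (W (false, 0%N) w) (W (true, 0%N) w).
Proof.
pose h (i j : nat) (b : bool) := (b, if b then j else i).
have hinj a b : injective (h a b) by move=> ? ? [->].
have bf : bmeas (fun z : conf E bool => ell (z false) (z true)).
  apply: (@bmeas_comp _ _ _ _ _ (fun z : conf E bool => (z false, z true)) _ _ bell).
  by apply: measurable_fun_pair; exact: measurable_coord.
apply: (indep_Rintegral_eq (indep_inj (hinj i j) iW) (indep_inj (hinj 0 0)%N iW) _ bf).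
by move=> b; exact: eqW.
Qed.

(** The sample has the same law under each relabelling [q] of the deliveries, so [n!] times the mean
    tour is the mean of the sum bounded in [sum_tour_conf_le]. *)
Lemma E_tour_le n :
  \int[P]_w tour_conf (fun bi : bool * 'I_n => W (bi.1, val bi.2) w) <=
  n%:R * \int[P]_w ell (W (false, 0%N) w) (W (true, 0%N) w) +
  \int[P]_w assign_conf (fun bi : bool * 'I_n => W (bi.1, val bi.2) w) +
  2 * D * \sum_(k < n) k.+1%:R^-1.
Proof.
pose h (q : {perm 'I_n}) (bi : bool * 'I_n) : bool * nat :=
  (bi.1, val (if bi.1 then bi.2 else q bi.2)).
have hinj q : injective (h q).
  move=> [b i] [b' i'] [<-] /val_inj /=; case: b => [->//|/perm_inj ->//].
have sinj : injective (fun bi : bool * 'I_n => (bi.1, val bi.2)).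
  by move=> [b i] [b' i'] [-> /val_inj ->].
have iS := indep_inj sinj iW.
have iH q := indep_inj (hinj q) iW.
have bt := bmeas_tour_conf n.
have Eq q : \int[P]_w tour_conf (fun bi : bool * 'I_n => W (bi.1, val bi.2) w) =
    \int[P]_w tour_conf (fun bi : bool * 'I_n => W (h q bi) w).
  by apply: (indep_Rintegral_eq iS (iH q) _ bt) => -[b i]; exact: eqW.
have btq q := bmeas_comp (measurable_family (iH q)) bt.
have bl i j : bmeas (fun w => ell (W i w) (W j w)).
  apply: (@bmeas_comp _ _ _ _ _ (fun w => (W i w, W j w)) _ _ bell).
  by apply: measurable_fun_pair; case: iW.
have ba : bmeas (fun w => assign_conf (fun bi : bool * 'I_n => W (bi.1, val bi.2) w)).
  exact: (bmeas_comp (measurable_family iS) (bmeas_assign_conf n)).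
rewrite -(ler_pM2l (_ : 0 < n`!%:R)) ?ltr0n ?fact_gt0//.
have -> : n`!%:R * \int[P]_w tour_conf (fun bi : bool * 'I_n => W (bi.1, val bi.2) w) =
   \int[P]_w \sum_(q : {perm 'I_n}) tour_conf (fun bi : bool * 'I_n => W (h q bi) w).
  rewrite bmeas_Rintegral_sum//; under eq_bigr do rewrite -Eq.
  by rewrite sumr_const mulr_natl [X in _ = _ *+ X]card_Sn.
apply: (@le_trans _ _ (\int[P]_w (
  \sum_(q : {perm 'I_n}) \sum_(i < n) ell (W (false, val (q i)) w) (W (true, val i) w) +
  n`!%:R * (assign_conf (fun bi : bool * 'I_n => W (bi.1, val bi.2) w)
     + 2 * D * \sum_(k < n) k.+1%:R^-1)))).
  apply: le_bmeas_Rintegral.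
  - exact: bmeas_sum.
  - apply: bmeasD; first by apply: bmeas_sum => q; apply: bmeas_sum => i; exact: bl.
    by apply: bmeasZ; apply: bmeasD => //; exact: bmeas_cst.
  - by move=> w; exact: (sum_tour_conf_le (fun bi => W (bi.1, val bi.2) w)).
rewrite bmeas_RintegralD; last 2 first.
- by apply: bmeas_sum => q; apply: bmeas_sum => i; exact: bl.
- by apply: bmeasZ; apply: bmeasD => //; exact: bmeas_cst.
rewrite bmeas_RintegralZl; last by apply: bmeasD => //; exact: bmeas_cst.
rewrite bmeas_RintegralD//; last exact: bmeas_cst.
rewrite probability_Rintegral_cst -addrA [leRHS]mulrDr lerD2r bmeas_Rintegral_sum; last first.
  by move=> q; apply: bmeas_sum => i; exact: bl.
under eq_bigr => q _.
  rewrite bmeas_Rintegral_sum; last by move=> i; exact: bl.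
  under eq_bigr do rewrite E_ell_pair.
  rewrite sumr_const card_ord; over.
by rewrite sumr_const !mulr_natl [X in _ *+ X <= _]card_Sn.
Qed.

End Means.

(** * Replacement of one sample along a coupling *)

Section Coupling.
Context d (T : measurableType d) (P : probability T R) (n : nat).
Context (W : (bool * 'I_n) + 'I_n -> T -> E).
Context dS (S : measurableType dS) (ga : probability S R) (z1 z2 : S -> E).
Hypothesis iW : indep P W.
Hypotheses (mz1 : measurable_fun setT z1) (mz2 : measurable_fun setT z2).
Hypothesis ga1 : forall i, law_eq ga P z1 (W (inl (false, i))).
Hypothesis ga2 : forall i, law_eq ga P z2 (W (inr i)).

(* The sample is replaced one coordinate at a time, the new coordinate being
   drawn jointly with the old one. *)
Lemma E_assign_coupling :
  \int[P]_w assign_conf (fun bi => W (inl bi) w) <=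
  n%:R * \int[ga]_e ell (z1 e) (z2 e) +
  \int[P]_w assign_conf (fun bi : bool * 'I_n => W (if bi.1 then inl bi else inr bi.2) w).
Proof.
(* Hybrid sample: the first [k] points with flag [false] are already replaced. *)
pose h k (bi : bool * 'I_n) : (bool * 'I_n) + 'I_n :=
  if bi.1 then inl bi else if (bi.2 < k)%N then inr bi.2 else inl bi.
have hinj k : injective (h k).
  move=> [[] i] [[] i']; rewrite /h /=;
    by repeat case: ifP => _; move=> // -[] ->.
have iH k := indep_inj (hinj k) iW.
have ba := bmeas_assign_conf n.
pose V k := \int[P]_w assign_conf (fun bi => W (h k bi) w).
have step (k : 'I_n) : V k <= V k.+1 + \int[ga]_e ell (z1 e) (z2 e).
  (* The old and the new point [k] are read off the same point of [S], hence coupled by [ga], while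
     each hybrid sample separately keeps its law. *)
  have [i1 L1 L1j] := indep_resample ga (false, k) (iH k) mz1.
  have [i2 L2 L2j] := indep_resample ga (false, k) (iH k) mz2.
  have hk : h k (false, k) = inl (false, k) by rewrite /h /= ltnn.
  have hk1 : h k.+1 (false, k) = inr k by rewrite /h /= ltnSn.
  have hne j : j != (false, k) -> h k j = h k.+1 j.
    case: j => -[] i //; rewrite xpair_eqE /= => ik; rewrite /h /=.
    by rewrite ltnS (leq_eqVlt i) (_ : (nat_of_ord i == k) = false)//; apply/negbTE.
  have -> : V k = _ := indep_Rintegral_eq (iH k) i1 _ ba; last first.
    move=> j A mA; have [->|jk] := eqVneq j (false, k).
      by rewrite (L1j A mA) (ga1 k mA) hk.
    by rewrite (L1 j jk A mA).
  have -> : V k.+1 = _ := indep_Rintegral_eq (iH k.+1) i2 _ ba; last first.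
    move=> j A mA; have [->|jk] := eqVneq j (false, k).
      by rewrite (L2j A mA) (ga2 k mA) hk1.
    by rewrite (L2 j jk A mA) hne.
  have bl : bmeas (fun we : T * S => ell (z1 we.2) (z2 we.2)).
    apply: (@bmeas_comp _ _ _ _ _ (fun we : T * S => (z1 we.2, z2 we.2)) _ _ bell).
    by apply: measurable_fun_pair; exact: measurableT_comp.
  have -> : \int[ga]_e ell (z1 e) (z2 e) = \int[(P \x ga)%E]_we ell (z1 we.2) (z2 we.2).
    by rewrite (bmeas_fubini_Rintegral P ga bl) /= probability_Rintegral_cst.
  have b1 := bmeas_comp (measurable_family i1) ba.
  have b2 := bmeas_comp (measurable_family i2) ba.
  apply: (@le_trans _ _ (\int[(P \x ga)%E]_we (assign_conf (fun bi => upd (fun j => W (h k j) we.1)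
      (false, k) (z2 we.2) bi) + ell (z1 we.2) (z2 we.2)))); last by rewrite (bmeas_RintegralD (P \x ga)%E b2 bl).
  apply: (le_bmeas_Rintegral (P \x ga)%E b1 (bmeasD b2 bl)).
  by move=> we; exact: assign_conf_lipschitz.
have tele m : (m <= n)%N -> V 0%N <= V m + m%:R * \int[ga]_e ell (z1 e) (z2 e).
  elim: m => [_|m IHm mn]; first by rewrite mul0r addr0.
  apply: le_trans (IHm (ltnW mn)) _.
  by have := step (Ordinal mn); rewrite -natr1 mulrDl mul1r /=; lra.
have V0 : V 0%N = \int[P]_w assign_conf (fun bi => W (inl bi) w).
  by rewrite /V; apply: eq_Rintegral => w _; congr assign_conf; apply/funext => -[[] i].
have Vn : V n = \int[P]_w assign_conf (fun bi : bool * 'I_n => W (if bi.1 then inl bi else inr bi.2) w).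
  rewrite /V; apply: eq_Rintegral => w _; congr assign_conf; apply/funext => -[[] i] //.
  by rewrite /h /= ltn_ord.
by rewrite -V0 -Vn addrC; exact: tele.
Qed.

End Coupling.

End MeanBounds.

(** * Densities and Euclidean geometry *)

Section Density.
Context (R : realType) d (T : measurableType d) (P : probability T R).
Context dE (E : measurableType dE) (lam : {measure set E -> \bar R}).
Context (Z : T -> E) (phi : E -> R).
Hypotheses (mZ : measurable_fun setT Z) (mphi : measurable_fun setT phi).
Hypothesis phi0 : forall x, 0 <= phi x.
Hypothesis PZ : forall A, measurable A -> P (Z @^-1` A) = (\int[lam]_(x in A) (phi x)%:E)%E.

Import HBNNSimple.
Local Open Scope ereal_scope.

Let nu : {measure set E -> \bar R} :=
  measure_function_pushforward__canonical__measure_function_Measure P mZ.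

Let density_indic (A : set E) : measurable A ->
  \int[nu]_x (\1_A x)%:E = \int[lam]_x ((\1_A x)%:E * (phi x)%:E).
Proof.
move=> mA; rewrite integral_indic//= setIT /nu /= /pushforward PZ//.
rewrite [LHS]integral_mkcond/=; apply: eq_integral => x _.
by rewrite patchE indicE; case: ifPn => _; rewrite ?mul1e ?mul0e.
Qed.

Let density_nnsfun (f : {nnsfun E >-> R}) :
  \int[nu]_x (f x)%:E = \int[lam]_x ((f x)%:E * (phi x)%:E).
Proof.
under [LHS]eq_integral do rewrite fimfunE -fsumEFin//.
rewrite [LHS]ge0_integral_fsum//; last 2 first.
  - by move=> r; exact/measurable_EFinP/measurableT_comp.
  - by move=> n x _; rewrite EFinM nnfun_muleindic_ge0.
under [RHS]eq_integral.
  move=> x xD; rewrite fimfunE -fsumEFin// muleC ge0_mule_fsumr; last first.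
    by move=> r; rewrite EFinM nnfun_muleindic_ge0.
  over.
rewrite [RHS]ge0_integral_fsum//; last 2 first.
  - move=> r; apply/measurable_EFinP/measurable_funM => //.
    exact/measurable_funM/measurable_indic.
  - move=> n x _; rewrite EFinM mule_ge0//; first by rewrite lee_fin.
    by rewrite nnfun_muleindic_ge0.
apply: eq_fsbigr => r _.
rewrite [LHS]integralZl_indic_nnsfun// density_indic//.
have [r0|r0] := leP 0%R r; last first.
  have -> : f @^-1` [set r] = set0.
    by apply/seteqP; split => // x /= fx; move: r0; rewrite -fx ltNge fun_ge0.
  under eq_integral do rewrite indic0 mul0e.
  rewrite integral0 mule0; under eq_integral do rewrite indic0 mulr0 mule0.
  by rewrite integral0.
rewrite -ge0_integralZl//.
- by apply: eq_integral => x _; rewrite -!EFinM; congr (_%:E); ring.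
- by apply/measurable_EFinP/measurable_funM => //; exact: measurable_indic.
- by move=> x _; rewrite -EFinM lee_fin mulr_ge0.
Qed.

Lemma ge0_integral_density (f : E -> \bar R) : measurable_fun setT f ->
  (forall x, 0 <= f x) -> \int[P]_w f (Z w) = \int[lam]_x (f x * (phi x)%:E).
Proof.
move=> mf f0.
have -> : \int[P]_w f (Z w) = \int[nu]_x f x.
  by rewrite /nu ge0_integral_pushforward// preimage_setT.
pose f_ := nnsfun_approx measurableT mf.
transitivity (lim (\int[nu]_x (f_ n x)%:E @[n --> \oo])).
  rewrite -monotone_convergence//.
  - apply: eq_integral => x _; apply/esym/cvg_lim => //=.
    exact: cvg_nnsfun_approx.
  - by move=> n; exact/measurable_EFinP/measurable_funTS.
  - by move=> n ? _; rewrite lee_fin.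
  - by move=> ? _ ? ? mn; rewrite lee_fin; exact/lefP/nd_nnsfun_approx.
transitivity (lim (\int[lam]_x ((f_ n x)%:E * (phi x)%:E) @[n --> \oo])).
  by apply: congr_lim; apply/funext => n /=; exact: density_nnsfun.
rewrite -monotone_convergence//=.
- apply: eq_integral => x _; apply/cvg_lim => //=.
  apply: cvgeZr => //; exact: cvg_nnsfun_approx.
- move=> n; apply: emeasurable_funM; last exact/measurable_EFinP.
  exact/measurable_EFinP/measurable_funTS.
- by move=> n x _; rewrite -EFinM lee_fin mulr_ge0.
- move=> x _ m n mn; rewrite -!EFinM lee_fin ler_wpM2r//.
  exact/lefP/nd_nnsfun_approx.
Qed.

End Density.

(** * Euclidean distance and retraction to the compact set *)

Section Euclid.
Context (R : realType) (d : nat).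
Implicit Types u v w : vecR R d.

Lemma enorm_ge0 u : 0 <= enorm u. Proof. exact: sqrtr_ge0. Qed.

Lemma enorm0 : enorm (0 : vecR R d) = 0.
Proof. by rewrite /enorm big1 ?sqrtr0// => i _; rewrite mxE expr0n. Qed.

Lemma sqr_enorm u : enorm u ^+ 2 = \sum_(i < d) u ord0 i ^+ 2.
Proof. by rewrite /enorm sqr_sqrtr// sumr_ge0// => i _; exact: sqr_ge0. Qed.

Lemma enormN u : enorm (- u) = enorm u.
Proof. by rewrite /enorm; under eq_bigr do rewrite mxE sqrrN. Qed.

Lemma enorm_distC u v : enorm (u - v) = enorm (v - u).
Proof. by rewrite -enormN opprB. Qed.

(** Lagrange's identity: the double sum of squares is twice the difference of the two sides. *)
Lemma cauchy_schwarz_sum (a b : 'I_d -> R) :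
  (\sum_i a i * b i) ^+ 2 <= (\sum_i a i ^+ 2) * (\sum_i b i ^+ 2).
Proof.
have : 0 <= \sum_i \sum_j (a i * b j - a j * b i) ^+ 2.
  by apply: sumr_ge0 => i _; apply: sumr_ge0 => j _; exact: sqr_ge0.
have -> : \sum_i \sum_j (a i * b j - a j * b i) ^+ 2 =
  \sum_i \sum_j (a i ^+ 2 * b j ^+ 2) - 2 * (\sum_i \sum_j (a i * b i) * (a j * b j))
  + \sum_i \sum_j (a j ^+ 2 * b i ^+ 2).
  rewrite big_distrr /= -sumrB -big_split /=; apply: eq_bigr => i _.
  rewrite big_distrr /= -sumrB -big_split /=; apply: eq_bigr => j _; ring.
rewrite [X in _ + X]exchange_big /= -!big_distrlr /= -expr2; lra.
Qed.

Lemma enorm_triangle u v : enorm (u + v) <= enorm u + enorm v.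
Proof.
rewrite -ler_sqr ?nnegrE ?addr_ge0 ?enorm_ge0// sqrrD !sqr_enorm.
under eq_bigr do rewrite mxE sqrrD.
rewrite !big_split /= lerD2r lerD2l mulr2n -!mulr2n lerMn2r /=.
have [h|h] := leP (\sum_(i < d) u ord0 i * v ord0 i) 0.
  by rewrite (le_trans h)// mulr_ge0 ?enorm_ge0.
rewrite -ler_sqr ?nnegrE ?mulr_ge0 ?enorm_ge0//; last exact: ltW.
by rewrite exprMn !sqr_enorm; exact: cauchy_schwarz_sum.
Qed.

Lemma enorm_dist_triangle u v w : enorm (u - w) <= enorm (u - v) + enorm (v - w).
Proof. by rewrite (_ : u - w = (u - v) + (v - w)) ?enorm_triangle// addrA subrK. Qed.

Lemma enorm_le_sum u : enorm u <= \sum_(i < d) `|u ord0 i|.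
Proof.
have s0 (s : seq 'I_d) : 0 <= \sum_(i <- s) `|u ord0 i| by exact: sumr_ge0.
rewrite -ler_sqr ?nnegrE ?enorm_ge0// sqr_enorm.
elim: (index_enum _) => [|i s IHs]; first by rewrite !big_nil expr0n.
rewrite !big_cons sqrrD -normrX ger0_norm ?sqr_ge0// -addrA lerD2l.
by rewrite (le_trans IHs)// lerDr mulrn_wge0// mulr_ge0.
Qed.

Lemma coord_le_norm u i : `|u ord0 i| <= `|u|.
Proof. by rewrite [leRHS]mx_normrE; exact: (le_bigmax _ _ (ord0, i)). Qed.

Lemma measurable_coordinate (i : 'I_d) :
  measurable_fun setT (fun x : Rd R d => (x : vecR R d) ord0 i).
Proof.
apply: (measurability _ (RGenOpens.measurableE R)).
move=> _ [_ [a [b ->]] <-]; rewrite setTI; apply: sub_sigma_algebra.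
apply: (open_comp (f := fun x : vecR R d => x ord0 i)).
  by move=> x _; exact: coord_continuous.
exact: interval_open.
Qed.

Lemma measurable_enorm_dist :
  measurable_fun setT (fun p : Rd R d * Rd R d => enorm ((p.1 : vecR R d) - p.2)).
Proof.
apply: (@measurableT_comp _ _ _ _ _ _ (@Num.sqrt R)).
  by apply: continuous_measurable_fun; exact: sqrt_continuous.
apply: measurable_sum => i.
under eq_fun do rewrite !mxE.
by apply: measurable_funX; apply: measurable_funB;
  apply: (measurableT_comp (measurable_coordinate i)).
Qed.

Lemma closed_Rd_measurable (A : set (vecR R d)) : closed A ->
  measurable (A : set (Rd R d)).
Proof.
move=> cA; rewrite -[A]setCK; apply: measurableC; apply: sub_sigma_algebra.
exact: closed_openC.
Qed.

Definition retract (A : set (vecR R d)) (a x : Rd R d) : Rd R d :=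
  if x \in A then x else a.

Lemma measurable_retract A a : closed A -> measurable_fun setT (retract A a).
Proof.
move=> cA; have mA := closed_Rd_measurable cA; move=> _ B mB; rewrite setTI.
have [aB|aB] := pselect (B a).
  rewrite (_ : _ @^-1` _ = ((A : set (Rd R d)) `&` B) `|` ~` (A : set (Rd R d))).
    by apply: measurableU; [exact: measurableI|exact: measurableC].
  apply/seteqP; split => x; rewrite /retract /=; case: ifPn; rewrite ?inE ?notin_setE.
  - by move=> Ax Bx; left.
  - by move=> nAx _; right.
  - by move=> Ax [[]//|/(_ Ax)].
  - by [].
rewrite (_ : _ @^-1` _ = (A : set (Rd R d)) `&` B); first exact: measurableI.
apply/seteqP; split => x; rewrite /retract /=; case: ifPn; rewrite ?inE ?notin_setE //.
  by move=> _ [].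
by move=> nAx [].
Qed.

Lemma retractE A a x : A x -> retract A a x = x.
Proof. by move=> Ax; rewrite /retract mem_set. Qed.

Lemma retract_in A a x : A a -> A (retract A a x).
Proof. by move=> Aa; rewrite /retract; case: ifPn => //; rewrite inE. Qed.

Lemma compact_coord_bound (A : set (vecR R d)) : compact A ->
  exists2 B : R, 0 < B & forall x i, A x -> `|x ord0 i| <= B.
Proof.
move=> /compact_bounded[M [_ hM]]; exists (Num.max 0 M + 1).
  by rewrite ltr_pwDr// le_max lexx.
move=> x i Ax; apply: le_trans (coord_le_norm _ _) _.
by apply: hM => //; rewrite ltr_pwDr// le_max lexx orbT.
Qed.

(** A bounded pseudo-distance when [A] is compact and contains [a]: all points outside [A] are
    identified with [a]. *)
Definition retract_dist (A : set (vecR R d)) (a u v : Rd R d) : R :=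
  enorm ((retract A a u : vecR R d) - retract A a v).

Lemma retract_distE A a u v : A u -> A v ->
  retract_dist A a u v = enorm ((u : vecR R d) - v).
Proof. by move=> Au Av; rewrite /retract_dist !retractE. Qed.

Lemma retract_dist_sym A a u v : retract_dist A a u v = retract_dist A a v u.
Proof. exact: enorm_distC. Qed.

Lemma retract_dist_triangle A a u v t :
  retract_dist A a u t <= retract_dist A a u v + retract_dist A a v t.
Proof. exact: enorm_dist_triangle. Qed.

Lemma retract_dist_bound (A : set (vecR R d)) a : compact A -> A a ->
  exists2 D : R, 0 <= D & forall u v, 0 <= retract_dist A a u v <= D.
Proof.
move=> /compact_coord_bound[B B0 AB] Aa; exists (\sum_(i < d) (2 * B)).
  by apply: sumr_ge0 => i _; rewrite mulr_ge0// ltW.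
move=> u v; rewrite enorm_ge0 /=; apply: le_trans (enorm_le_sum _) _.
apply: ler_sum => i _; rewrite !mxE (le_trans (ler_normB _ _))// mulr_natl mulr2n.
by rewrite lerD// AB//; exact: retract_in.
Qed.

Lemma retract_dist_bmeas (A : set (vecR R d)) a : compact A -> A a ->
  bmeas (fun p : Rd R d * Rd R d => retract_dist A a p.1 p.2).
Proof.
move=> cA Aa; have [D D0 AD] := retract_dist_bound cA Aa; split; last first.
  by exists D => p; have /andP[? ?] := AD p.1 p.2; rewrite ger0_norm.
have cl : closed A by apply: compact_closed => //; exact: norm_hausdorff.
apply: (@measurableT_comp _ _ _ _ _ _ (fun p : Rd R d * Rd R d => enorm ((p.1 : vecR R d) - p.2))
  _ (fun p : Rd R d * Rd R d => (retract A a p.1, retract A a p.2))).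
  exact: measurable_enorm_dist.
by apply: measurable_fun_pair; apply: measurableT_comp => //; exact: measurable_retract.
Qed.

End Euclid.

(** * Almost sure concentration *)

Section BorelCantelli.
Context (R : realType) d (T : measurableType d) (P : probability T R).

Lemma borel_cantelli_sq (A : (set T)^nat) (K : R) (n0 : nat) :
  (forall n, measurable (A n)) -> 0 <= K ->
  (forall n, (n0 <= n)%N -> (P (A n) <= (K / n%:R ^+ 2)%:E)%E) ->
  {ae P, forall w, \forall n \near \oo, ~ A n w}.
Proof.
move=> mA K0 PA.
(* The initial events are emptied, so that the whole series can be summed. *)
pose F n := if (n <= n0)%N then set0 else A n.
have mF n : measurable (F n) by rewrite /F; case: ifP.
have PF n : (P (F n) <= (if n is m.+1 then K / n%:R ^+ 2 else 0)%:E)%E.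
  rewrite /F; case: leqP => [_|n0n].
    rewrite measure0 lee_fin; case: n => // n.
    by rewrite divr_ge0// exprn_ge0.
  by apply: le_trans (PA _ (ltnW n0n)) _; rewrite lee_fin; case: n n0n.
(* [1 / (n + 1)^2 <= 1 / n - 1 / (n + 1)] telescopes; the term of index [1] adds a further [K]. *)
have partial N : (\sum_(0 <= n < N.+2) P (F n) <= (K * (2 - N.+1%:R^-1))%:E)%E.
  elim: N => [|N IHN].
    rewrite big_nat_recr//= big_nat_recr//= big_geq// add0e.
    have := PF 0%N; have := PF 1%N; rewrite /= expr1n => h1 h0.
    apply: le_trans (leeD h0 h1) _; rewrite -EFinD lee_fin; lra.
  rewrite big_nat_recr//=; apply: le_trans (leeD IHN (PF _)) _.
  rewrite -EFinD lee_fin -mulrDr ler_wpM2l//.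
  have N1 : 0 < N.+1%:R :> R by [].
  have N2 : 0 < N.+2%:R :> R by [].
  suff : (N.+2%:R ^+ 2)^-1 <= N.+1%:R^-1 - N.+2%:R^-1 :> R.
    by move: (N.+1%:R^-1) (N.+2%:R^-1) ((N.+2%:R ^+ 2)^-1) => a b e; lra.
  have -> : N.+1%:R^-1 - N.+2%:R^-1 = (N.+1%:R * N.+2%:R)^-1 :> R.
    rewrite -(natr1 N.+1); move: (N.+1%:R) N1 => x x0.
    by field; apply/andP; split; apply: lt0r_neq0; lra.
  rewrite lef_pV2 ?posrE ?exprn_gt0 ?mulr_gt0// expr2 ler_wpM2r//.
  by rewrite ler_nat.
have sumF : (\sum_(n <oo) P (F n) < +oo)%E.
  apply: (@le_lt_trans _ _ (K * 2)%:E); last exact: ltry.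
  apply: lime_le; first exact: is_cvg_nneseries.
  near=> N.
  have -> : N = N.-2.+2 by near: N; exists 2%N => // -[|[|]].
  apply: le_trans (partial _) _; rewrite lee_fin ler_wpM2l// gerBl.
  by rewrite invr_ge0.
have := lim_sup_set_cvg0 mF sumF => N0.
exists (lim_sup_set F); split => //.
  by apply: bigcap_measurable => // k _; exact: bigcup_measurable.
move=> w /= nw k _; apply: contra_notP nw => nk.
exists (maxn k n0.+1) => // n /=; rewrite geq_max => /andP[kn n0n] Anw.
by apply: nk; exists n => //; rewrite /F leqNgt n0n.
Unshelve. all: by end_near. Qed.

End BorelCantelli.

Section Concentration.
Context (R : realType) dE (E : measurableType dE).
Context d (T : measurableType d) (P : probability T R) (I : eqType) (W : I -> T -> E).
Hypothesis iW : indep P W.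
Context (h : forall n, bool * 'I_n -> I) (hinj : forall n, injective (@h n)).
Context (f : forall n, (bool * 'I_n -> E) -> R) (c : R).
Hypothesis c0 : 0 <= c.
Hypothesis bf : forall n, bmeas (@f n : conf E (bool * 'I_n)%type -> R).
Hypothesis f_diff : forall n z j u, `|@f n (upd z j u) - @f n z| <= c.

Let F n w := @f n (fun bi => W (h bi) w).

(** With [s = 1 / sqrt n] the [2 n] coordinates contribute the constant [4 c^2], whatever [n]. The
    tail is exponential in [t / sqrt n] rather than Gaussian, which suffices for the deviations
    used. The first hypothesis says [s c <= 1 / 2]. *)
Lemma concentration_tail n (t : R) : (2 * c) ^+ 2 <= n%:R -> (0 < n)%N ->
  (P [set w | (\int[P]_v F n v + t <= F n w)%R] <=
    (expR (4 * c ^+ 2 - t / Num.sqrt n%:R))%:E)%E.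
Proof.
move=> cn n0; have n0' : 0 < n%:R :> R by rewrite ltr0n.
have sn0 : 0 < Num.sqrt n%:R :> R by rewrite sqrtr_gt0.
have sE : Num.sqrt n%:R ^+ 2 = n%:R :> R by rewrite sqr_sqrtr// ltW.
have := @mcdiarmid_tail _ _ _ _ _ _ P _ (indep_inj (@hinj n) iW) c (Num.sqrt n%:R)^-1 t
  (enum {: bool * 'I_n}) _ c0 _ _ (bf n) _ (@f_diff n).
rewrite -cardE card_prod card_bool card_ord.
have -> : (2 * n)%:R * (2 * ((Num.sqrt n%:R)^-1 * c) ^+ 2) = 4 * c ^+ 2 :> R.
  rewrite exprMn exprVn sE natrM; field; exact: lt0r_neq0.
rewrite [_^-1 * t]mulrC; apply.
- by rewrite invr_ge0 ltW.
- rewrite mulrC ler_pdivrMr// mulrC ler_pdivlMr// mulrC.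
  by rewrite -ler_sqr ?nnegrE ?mulr_ge0// ?sE// ltW.
- by move=> z z' zz'; congr f; apply/funext => j; apply: zz'; rewrite mem_enum inE.
Qed.

Let bF n : bmeas (F n).
Proof. exact: (bmeas_comp (measurable_family (indep_inj (@hinj n) iW)) (bf n)). Qed.

(** A deviation of [2 ln n] in units of [sqrt n] has probability of order [n^-2], which is
    summable. *)
Lemma concentration_ae : {ae P, forall w, \forall n \near \oo,
  F n w <= \int[P]_v F n v + 2 * (Num.sqrt n%:R * ln n%:R)}.
Proof.
pose A n := [set w | \int[P]_v F n v + 2 * (Num.sqrt n%:R * ln n%:R) <= F n w].
have mA n : measurable (A n).
  rewrite -[A n]setTI; apply: measurable_fun_le => //.
  by have [] := bF n.
have := @borel_cantelli_sq _ _ _ P A (expR (4 * c ^+ 2)) (Num.truncn ((2 * c) ^+ 2)).+1 mA.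
move=> /(_ (expR_ge0 _)) BC.
apply: filterS (BC _) => [w|].
  by apply: filterS => n /= /negP; rewrite -ltNge => /ltW.
move=> n nn; have cn : (2 * c) ^+ 2 <= n%:R.
  apply: le_trans (ltW (truncnS_gt _)) _; by rewrite ler_nat.
have n0 : (0 < n)%N by exact: leq_trans nn.
apply: le_trans (concentration_tail _ cn n0) _; rewrite lee_fin expRD.
rewrite ler_wpM2l ?expR_ge0//.
have -> : 2 * (Num.sqrt n%:R * ln n%:R) / Num.sqrt n%:R = ln n%:R + ln n%:R :> R.
  by field; rewrite gt_eqF// sqrtr_gt0 ltr0n.
by rewrite expRN expRD -expr2 lnK ?posrE ?ltr0n.
Qed.

End Concentration.

Lemma harmonic_le_ln (R : realType) (n : nat) : (0 < n)%N ->
  \sum_(k < n) k.+1%:R^-1 <= 1 + ln n%:R :> R.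
Proof.
case: n => // n _; elim: n => [|n IHn]; first by rewrite big_ord1 invr1 ln1 addr0.
rewrite big_ord_recr /=; apply: le_trans (lerD IHn (lexx _)) _; rewrite -addrA lerD2l.
have n1 : 0 < n.+1%:R :> R by [].
have n2 : 0 < n.+2%:R :> R by [].
have := @le_ln1Dx R (- n.+2%:R^-1).
rewrite ltrN2 invf_lt1// ltr1n => /(_ isT).
have -> : 1 - n.+2%:R^-1 = n.+1%:R / n.+2%:R :> R.
  rewrite -(natr1 n.+1); move: (n.+1%:R) n1 => x x0.
  by field; apply: lt0r_neq0; lra.
rewrite ln_div ?posrE//.
by move: (ln _) (ln _) (n.+2%:R^-1) => a b e; lra.
Qed.

Lemma ln_le_powR (R : realType) (x a : R) : 0 < x -> 0 < a -> ln x <= a^-1 * x `^ a.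
Proof.
move=> x0 a0; rewrite -(ler_pM2l a0) mulrA mulfV ?gt_eqF// mul1r -ln_powR.
exact/ltW/ln_sublinear/powR_gt0.
Qed.

Lemma scale_dominates (R : realType) (d : nat) (K eps : R) : (3 <= d)%N ->
  0 <= K -> 0 < eps ->
  \forall n \near \oo, K * (Num.sqrt n%:R * ln n%:R + 1) <= eps * scale_d R d n.
Proof.
move=> d3 K0 e0.
(* [ln n <= 12 n^(1/12)] bounds the left side by [13 K n^(7/12)], and [7/12] is less than
   [2/3 <= 1 - 1/d]; from [B] on, the spare power [n^(1/12)] is at least [13 K / eps]. *)
pose B := (13 * K / eps) ^+ 12.
near=> n.
have n1 : 1 <= n%:R :> R.
  by rewrite ler1n; near: n; exists 1%N.
have nB : B <= n%:R.
  near: n; exists (Num.truncn B).+1 => // m /= Bm.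
  by apply: le_trans (ltW (truncnS_gt _)) _; rewrite ler_nat.
have n0 : 0 < n%:R :> R by exact: lt_le_trans n1.
have p0 a : 0 < n%:R `^ a :> R by exact: powR_gt0.
have l1 : ln n%:R <= 12 * n%:R `^ (12^-1) :> R.
  by have := @ln_le_powR R n%:R 12^-1 n0; rewrite invrK; apply; rewrite invr_gt0.
have s1 : Num.sqrt n%:R * ln n%:R <= 12 * n%:R `^ (7 / 12) :> R.
  rewrite -powR12_sqrt; last exact: ltW.
  apply: le_trans (ler_wpM2l (ltW (p0 _)) l1) _.
  rewrite mulrCA -powRD; last by rewrite gt_eqF ?implybT// n0.
  by rewrite (_ : 2^-1 + 12^-1 = 7 / 12 :> R)//; lra.
have s2 : 1 <= n%:R `^ (7 / 12) :> R.
  by rewrite -[leLHS](powRr0 n%:R); apply: ler_powR => //; lra.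
apply: (@le_trans _ _ (K * (13 * n%:R `^ (7 / 12)))).
  by rewrite ler_wpM2l//; lra.
apply: (@le_trans _ _ (eps * n%:R `^ (2 / 3))); last first.
  rewrite ler_pM2l// /scale_d; apply: ler_powR => //.
  have : d%:R^-1 <= 3^-1 :> R by rewrite lef_pV2 ?posrE ?ler_nat// ltr0n (leq_trans _ d3).
  lra.
rewrite (_ : 2 / 3 = 12^-1 + 7 / 12 :> R); last by lra.
rewrite powRD; last by rewrite gt_eqF ?implybT// n0.
rewrite !mulrA ler_pM2r//.
have -> : K * 13 = eps * (13 * K / eps) by field; exact: lt0r_neq0.
rewrite ler_pM2l//.
have b0 : 0 <= 13 * K / eps by rewrite divr_ge0 ?mulr_ge0// ltW.
rewrite -[leLHS](powRr1 b0) -[X in _ `^ X](mulfV (_ : 12 != 0 :> R)) ?pnatr_eq0//.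
by rewrite powRrM powR_mulrn// ge0_ler_powR ?nnegrE ?invr_ge0// ?exprn_ge0// ltW.
Unshelve. all: by end_near. Qed.

(** * Planar samples *)

Section GridMeasurability.
Context (R : realType) dE (E : measurableType dE).

Lemma bmeas_truncn_eq (h : E -> R) (a : nat) : measurable_fun setT h ->
  (forall x, 0 <= h x) -> bmeas (fun x => (Num.truncn (h x) == a)%:R : R).
Proof.
move=> mh h0; split; last first.
  by exists 1 => x; case: (_ == _); rewrite ?normr1 ?normr0.
have -> : (fun x => (Num.truncn (h x) == a)%:R : R) = \1_(h @^-1` `[a%:R, a.+1%:R[%classic).
  apply/funext => x; rewrite indicE truncn_eq//; congr (_%:R); congr nat_of_bool.
  by apply/idP/idP; rewrite inE /= in_itv.
by apply: measurable_indic; rewrite -[X in measurable X]setTI; exact: mh.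
Qed.

(** Only the cells with both indices at most those of [z] contribute, so the map is a finite
    combination of indicators of cells. *)
Lemma bmeas_flow (k : nat -> nat -> R) (h1 h2 : E -> R) (z : nat * nat) :
  measurable_fun setT h1 -> (forall x, 0 <= h1 x) ->
  measurable_fun setT h2 -> (forall x, 0 <= h2 x) ->
  bmeas (fun x => flow k (Num.truncn (h1 x), Num.truncn (h2 x)) z).
Proof.
move=> mh1 h10 mh2 h20; case: z => i j.
have -> : (fun x => flow k (Num.truncn (h1 x), Num.truncn (h2 x)) (i, j)) =
  (fun x => \sum_(a < i.+1) \sum_(b < j.+1)
    ((Num.truncn (h1 x) == a)%:R * (Num.truncn (h2 x) == b)%:R * k (i - a)%N (j - b)%N)).
  apply/funext => x; rewrite /flow /=.
  move: (Num.truncn (h1 x)) (Num.truncn (h2 x)) => p q.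
  case: leqP => [pi|ip]; last first.
    rewrite big1// => a _; rewrite big1// => b _.
    by rewrite gtn_eqF ?mul0r// (leq_trans (ltn_ord a)).
  rewrite (bigD1 (Ordinal (pi : (p < i.+1)%N)))//= [X in _ = _ + X]big1 ?addr0; last first.
    move=> a ap; rewrite big1// => b _; rewrite (_ : (p == a) = false) ?mul0r//.
    by apply: contraNF ap => /eqP pa; apply/eqP/val_inj.
  case: leqP => [qj|jq]; last first.
    by rewrite big1// => b _; rewrite (gtn_eqF (leq_trans (ltn_ord b) jq)) mulr0 mul0r.
  rewrite (bigD1 (Ordinal (qj : (q < j.+1)%N)))//= [X in _ = _ + X]big1 ?addr0; last first.
    move=> b bq; rewrite (_ : (q == b) = false) ?mulr0 ?mul0r//.
    by apply: contraNF bq => /eqP qb; apply/eqP/val_inj.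
  by rewrite !eqxx !mul1r.
apply: bmeas_sum => a; apply: bmeas_sum => b; apply: bmeasM; last exact: bmeas_cst.
by apply: bmeasM; exact: bmeas_truncn_eq.
Qed.

End GridMeasurability.

Section Planar.
Context (R : realType) (Omega : set (vecR R 2)) (a0 : Rd R 2).
Hypothesis cOmega : compact Omega.
Hypothesis Oa0 : Omega a0.

Let r := retract Omega a0.
Let ell := retract_dist Omega a0.

Let cl : closed Omega.
Proof. by apply: compact_closed => //; exact: norm_hausdorff. Qed.

Section Grid.
Variables (B : R) (N : nat).
Hypotheses (B0 : 0 < B) (N0 : (0 < N)%N).
Hypothesis OB : forall x i, Omega x -> `|x ord0 i| <= B.

Let de := 2 * B / N%:R.
Let de0 : 0 < de.
Proof. by rewrite divr_gt0 ?mulr_gt0 ?ltr0n. Qed.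
Let i0 : 'I_2 := ord0.
Let i1 : 'I_2 := ord_max.
Let hh (i : 'I_2) (x : Rd R 2) : R := ((r x : vecR R 2) ord0 i + B) / de.

Let hh_bd i x : 0 <= hh i x <= N%:R.
Proof.
have := OB i (retract_in x Oa0); rewrite ler_norml => /andP[h1 h2].
rewrite /hh divr_ge0 ?(ltW de0)//; last by rewrite -/r in h1 *; lra.
rewrite ler_pdivrMr//= /de mulrCA mulfV ?pnatr_eq0 -?lt0n// mulr1.
by rewrite -/r in h2 *; lra.
Qed.

Let hh_meas i : measurable_fun setT (hh i).
Proof.
apply: measurable_funM => //; apply: measurable_funD => //.
by apply: (measurableT_comp (measurable_coordinate i)); exact: measurable_retract.
Qed.

Definition grid_cell (x : Rd R 2) : nat * nat := (Num.truncn (hh i0 x), Num.truncn (hh i1 x)).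

Lemma grid_cell_le x : ((grid_cell x).1 <= N)%N && ((grid_cell x).2 <= N)%N.
Proof.
have H i : (Num.truncn (hh i x) <= N)%N.
  have /andP[h0 hN] := hh_bd i x.
  by rewrite -(ler_nat R) (le_trans _ hN)// truncn_le.
by rewrite !H.
Qed.

Lemma bmeas_grid_flow k z : bmeas (fun x => flow k (grid_cell x) z : R).
Proof.
have h0 i x : 0 <= hh i x by have /andP[] := hh_bd i x.
by apply: bmeas_flow => // x; exact: h0.
Qed.

(** Lower left corner of a cell. The indices are unbounded because the flow runs up to the
    antidiagonal [6 N], beyond the cells of sample points. *)
Let pt (z1 z2 : nat) : vecR R 2 := \row_j (de * (if j == i0 then z1 else z2)%:R - B).

Let round x : enorm ((r x : vecR R 2) - pt (grid_cell x).1 (grid_cell x).2) <= 2 * de.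
Proof.
have H i : `|(r x : vecR R 2) ord0 i - (de * (Num.truncn (hh i x))%:R - B)| <= de.
  have /andP[h0 _] := hh_bd i x; have /andP[t1 t2] := truncn_itv h0.
  have E1 : (r x : vecR R 2) ord0 i = de * hh i x - B.
    by rewrite /hh mulrCA mulfV ?gt_eqF// mulr1 addrK.
  rewrite E1 opprB addrA subrK -mulrBr normrM gtr0_norm// ger_pMr//.
  rewrite -natr1 in t2.
  by rewrite ger0_norm; lra.
apply: le_trans (enorm_le_sum _) _; rewrite big_ord_recl big_ord1 !mxE /=.
rewrite mulr_natl mulr2n lerD//.
have -> : lift ord0 ord0 = i1 by apply/val_inj.
exact: H.
Qed.

Let step_x z1 z2 : enorm (pt z1.+1 z2 - pt z1 z2) <= de.
Proof.
apply: le_trans (enorm_le_sum _) _; rewrite big_ord_recl big_ord1 !mxE /=.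
rewrite subrr normr0 addr0 -natr1.
by rewrite (_ : _ - _ - _ = de) ?gtr0_norm//; ring.
Qed.

Let step_y z1 z2 : enorm (pt z1 z2.+1 - pt z1 z2) <= de.
Proof.
apply: le_trans (enorm_le_sum _) _; rewrite big_ord_recl big_ord1 !mxE /=.
rewrite subrr normr0 add0r -natr1.
by rewrite (_ : _ - _ - _ = de) ?gtr0_norm//; ring.
Qed.

(** Moving a point to the corner of its cell costs at most [2 * de], hence [4 * de] per pair;
    divided by [de], the potential has increments at most [1] along grid edges. *)
Lemma assign_le_flow n (z : bool * 'I_n -> Rd R 2) :
  assign_conf ell z <= 4 * n%:R * de + de *
  \sum_(i < 6 * N) \sum_(j < 6 * N)
    (`|\sum_(k < n) (flow (@urn_x R) (grid_cell (z (false, k))) (nat_of_ord i, nat_of_ord j)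
           - flow (@urn_x R) (grid_cell (z (true, k))) (nat_of_ord i, nat_of_ord j))| +
     `|\sum_(k < n) (flow (@urn_y R) (grid_cell (z (false, k))) (nat_of_ord i, nat_of_ord j)
           - flow (@urn_y R) (grid_cell (z (true, k))) (nat_of_ord i, nat_of_ord j))|).
Proof.
(* Duality is taken in the whole plane, so that the potential is Lipschitz also at grid points
   outside [Omega]. *)
pose dist (u v : vecR R 2) := enorm (u - v).
have [] := @assign_duality R (vecR R 2) dist n _ _ _
  (fun i => r (z (false, i))) (fun i => r (z (true, i))).
- by move=> u v t; exact: enorm_dist_triangle.
- by move=> u v; exact: enorm_ge0.
- by move=> u; rewrite /dist subrr enorm0.
move=> g [gL gE]; apply: le_trans gE _.
pose g0 a b := g (pt a b) / de.
have gabs u v : `|g u - g v| <= enorm (u - v).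
  by rewrite ler_norml lerNl opprB gL andbT enorm_distC; exact: gL.
have g0x a b : `|g0 a.+1 b - g0 a b| <= 1.
  rewrite -mulrBl normrM [`|de^-1|]gtr0_norm ?invr_gt0// ler_pdivrMr// mul1r.
  exact: le_trans (gabs _ _) (step_x a b).
have g0y a b : `|g0 a b.+1 - g0 a b| <= 1.
  rewrite -mulrBl normrM [`|de^-1|]gtr0_norm ?invr_gt0// ler_pdivrMr// mul1r.
  exact: le_trans (gabs _ _) (step_y a b).
have FB := @flow_bound R n N (fun k => grid_cell (z (false, k))) (fun k => grid_cell (z (true, k))) g0
  g0x g0y (fun k => grid_cell_le _) (fun k => grid_cell_le _).
apply: le_trans (lerD (lexx _) (ler_wpM2l (ltW de0) FB)).
have -> : 4 * n%:R * de = \sum_(k < n) (4 * de).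
  by rewrite sumr_const card_ord -[RHS]mulr_natr mulrAC.
rewrite big_distrr -big_split /=; apply: ler_sum => k _.
have gde a b : g (pt a b) = de * g0 a b by rewrite /g0 mulrCA mulfV ?mulr1// gt_eqF.
have := le_trans (gabs _ _) (round (z (false, k))).
have := le_trans (gabs _ _) (round (z (true, k))).
rewrite !gde !ler_norml => /andP[? ?] /andP[? ?]; lra.
Qed.

End Grid.

Lemma E_assign_planar : exists2 C : R, 0 <= C &
  forall d (T : measurableType d) (P : probability T R) (n : nat)
    (Z : bool * 'I_n -> T -> Rd R 2),
  indep P Z -> (forall i j, law_eq P P (Z i) (Z j)) ->
  bmeas (fun p : Rd R 2 * Rd R 2 => ell p.1 p.2) ->
  (3 <= n)%N -> 1 <= ln n%:R :> R ->
  \int[P]_w assign_conf ell (Z^~ w) <= C * Num.sqrt (n%:R * ln n%:R).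
Proof.
have [B B0 OB] := compact_coord_bound cOmega.
(* [100 = 8 + 72 + 20]: rounding, number of edges and energy, bounded in [T1], [T2] and [T3]. *)
exists (100 * B); first by rewrite mulr_ge0// ltW.
move=> d T P n Z iZ eqZ bell n3 ln1.
pose N := (Num.truncn (Num.sqrt n%:R : R)).+1.
have N0 : (0 < N)%N by [].
pose sn : R := Num.sqrt n%:R.
have n0 : 0 < n%:R :> R by rewrite ltr0n (leq_trans _ n3).
have sn0 : 0 < sn by rewrite sqrtr_gt0.
have snE : sn * sn = n%:R by rewrite -expr2 sqr_sqrtr// ltW.
have sn1 : 1 <= sn.
  by rewrite -sqrtr1 ler_sqrt// ler1n (leq_trans _ n3).
have Nsn : sn <= N%:R by exact/ltW/truncnS_gt.
have N2sn : N%:R <= 2 * sn.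
  have : (Num.truncn sn)%:R <= sn by rewrite truncn_le ltW.
  rewrite /N -natr1 -/sn; lra.
have Np : 0 < N%:R :> R by [].
pose sl : R := Num.sqrt (ln n%:R).
have l0 : 0 < ln n%:R :> R by lra.
have sl0 : 0 < sl by rewrite sqrtr_gt0.
have slE : sl * sl = ln n%:R by rewrite -expr2 sqr_sqrtr// ltW.
have sl1 : 1 <= sl by rewrite -sqrtr1 ler_sqrt// ?ltW.
rewrite sqrtrM ?(ltW n0)// -/sn -/sl.
(* Of order [sqrt (ln n)], which balances edges against energy: [la * n] and [n * ln n / la] are
   both of order [n * sqrt (ln n)]. *)
pose la := sn * sl / N%:R.
have la0 : 0 < la by rewrite divr_gt0// mulr_gt0.
(* [N] is at most [2 sqrt n], so [12 N <= 24 n <= n^4] for [n >= 3], and [1 + 4 ln n <= 5 ln n]. *)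
have H5 : \sum_(t < 6 * N + 6 * N) t.+1%:R^-1 <= 5 * (sl * sl).
  apply: le_trans (harmonic_le_ln _ _) _; first by rewrite addn_gt0 muln_gt0.
  have : ln (6 * N + 6 * N)%:R <= ln (n%:R ^+ 4) :> R.
    rewrite ler_ln ?posrE ?exprn_gt0//.
    rewrite -mulnDl natrM.
    have n3' : 3 <= n%:R :> R by rewrite ler_nat.
    have snn : sn <= n%:R by rewrite -snE ler_peMr// ltW.
    apply: (@le_trans _ _ (24 * n%:R)).
      by rewrite (_ : (6 + 6)%:R = 12 :> R)//; lra.
    rewrite exprS mulrC ler_pM2l//.
    apply: (@le_trans _ _ (3 ^+ 3)); first by rewrite -natrX ler_nat.
    by rewrite lerXn2r// ?nnegrE// ltW.
  rewrite lnXn// -slE -[_ *+ 4]mulr_natl; lra.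
pose fl k z w : R := \sum_(l < n) (flow k (grid_cell B N (Z (false, l) w)) z -
   flow k (grid_cell B N (Z (true, l) w)) z).
pose S w := \sum_(i < 6 * N) \sum_(j < 6 * N)
    (`|fl (@urn_x R) (nat_of_ord i, nat_of_ord j) w| + `|fl (@urn_y R) (nat_of_ord i, nat_of_ord j) w|).
have bfl k z j : bmeas (fun w => flow k (grid_cell B N (Z j w)) z : R).
  exact: (@bmeas_comp _ _ _ _ _ (Z j) _ (iZ.1 j) (bmeas_grid_flow B0 N0 OB k z)).
have bS : bmeas S.
  by apply: bmeas_sum => i; apply: bmeas_sum => j; apply: bmeasD; apply: bmeas_norm;
    apply: bmeas_sum => l; apply: bmeasB.
pose de := 2 * B / N%:R.
have de0 : 0 < de by rewrite divr_gt0// mulr_gt0.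
apply: (@le_trans _ _ (\int[P]_w (4 * n%:R * de + de * S w))).
  apply: le_bmeas_Rintegral.
  - exact: (bmeas_comp (measurable_family iZ) (bmeas_assign_conf bell n)).
  - by apply: bmeasD; [exact: bmeas_cst|exact: bmeasZ].
  - by move=> w; exact: (assign_le_flow B0 N0 OB).
rewrite bmeas_RintegralD; [|exact: bmeas_cst|exact: bmeasZ].
rewrite probability_Rintegral_cst bmeas_RintegralZl//.
have := E_flow_bound iZ eqZ (q := grid_cell B N) la0 (grid_cell_le B0 N0 OB)
  (bmeas_grid_flow B0 N0 OB).
rewrite -[X in X <= _ -> _]/(\int[P]_w S w) => ES.
apply: le_trans (lerD (lexx _) (ler_wpM2l (ltW de0) ES)) _.
have c0 : 0 <= 2 * n%:R / la by rewrite divr_ge0 ?mulr_ge0// ltW.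
have E1 := ler_wpM2l c0 H5.
apply: (@le_trans _ _ (4 * n%:R * de + de * (la * (6 * N)%:R ^+ 2 + 2 * n%:R / la * (5 * (sl * sl))))).
  by rewrite lerD2l ler_wpM2l ?(ltW de0)// lerD2l.
have T1 : 4 * n%:R * de <= 8 * B * (sn * sl).
  have h1 : n%:R / N%:R <= sn by rewrite ler_pdivrMr// -snE ler_pM2l.
  have h2 : sn <= sn * sl by rewrite ler_peMr// ltW.
  rewrite /de (_ : 4 * n%:R * (2 * B / N%:R) = 8 * B * (n%:R / N%:R)); last by ring.
  by rewrite ler_wpM2l ?mulr_ge0 ?(ltW B0)// (le_trans h1).
have T2 : de * (la * (6 * N)%:R ^+ 2) = 72 * B * (sn * sl).
  by rewrite /de /la natrM; field; exact: lt0r_neq0.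
have T3 : de * (2 * n%:R / la * (5 * (sl * sl))) = 20 * B * (sn * sl).
  by rewrite /de /la -snE; field; rewrite !lt0r_neq0.
by rewrite mulrDr T2 T3; lra.
Qed.

End Planar.

(** * Pickups and deliveries with densities *)

(** Supplies the base point to which the retraction sends all points outside [Omega]. *)
Lemma density_support_nonempty (R : realType) (d : nat)
    (lam : {measure set Rd R d -> \bar R}) (Omega : set (vecR R d)) (phi : Rd R d -> R) :
  is_density_on lam Omega phi -> exists a : Rd R d, Omega a.
Proof.
move=> [_ _ phi0 phi1]; apply: contrapT => nO.
have : (\int[lam]_x (phi x)%:E = 0)%E.
  by rewrite integral0_eq// => x _; rewrite phi0// => Ox; apply: nO; exists x.
by rewrite phi1 => -[/eqP]; rewrite oner_eq0.
Qed.

Section Law.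
Context (R : realType) (d : nat) (lam : {measure set Rd R d -> \bar R})
  (Omega : set (vecR R d)) (phiP phiD : Rd R d -> R)
  (dT : measure_display) (T : measurableType dT) (P : probability T R)
  (X Y : nat -> T -> Rd R d).
Hypotheses (cO : compact Omega) (dP : is_density_on lam Omega phiP)
  (dD : is_density_on lam Omega phiD)
  (hX : forall i, has_density P lam (X i) phiP)
  (hY : forall i, has_density P lam (Y i) phiD)
  (iXY : mutually_independent P (fun bi : bool * nat => if bi.1 then X bi.2 else Y bi.2)).
Variable a0 : Rd R d.
Hypothesis Oa0 : Omega a0.

Let W (bi : bool * nat) : T -> Rd R d := if bi.1 then X bi.2 else Y bi.2.
Let phi (b : bool) := if b then phiP else phiD.
Let ell := retract_dist Omega a0.

Let cl : closed Omega.
Proof. by apply: compact_closed => //; exact: norm_hausdorff. Qed.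

Let mO : measurable (Omega : set (Rd R d)).
Proof. exact: closed_Rd_measurable. Qed.

Let dphi b : is_density_on lam Omega (phi b).
Proof. by case: b. Qed.

Lemma family_density b i : has_density P lam (W (b, i)) (phi b).
Proof. by case: b; rewrite /W /=. Qed.

Lemma family_indep : indep P W.
Proof. by split => // -[b i]; case: (family_density b i). Qed.

Lemma family_law b i j : law_eq P P (W (b, i)) (W (b, j)).
Proof.
move=> A mA; have [_ ->//] := family_density b i.
by have [_ ->] := family_density b j.
Qed.

Lemma family_in_support : {ae P, forall w, forall b i, Omega (W (b, i) w)}.
Proof.
have H b : {ae P, forall w, forall i, Omega (W (b, i) w)}.
  apply: ae_foralln => i; exists (W (b, i) @^-1` ~` (Omega : set (Rd R d))).
  have mC : measurable (~` (Omega : set (Rd R d))) by exact: measurableC.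
  have [mW PW] := family_density b i; split => //.
    by rewrite -[X in measurable X]setTI; exact: mW.
  rewrite [LHS]PW//; have [_ _ p0 _] := dphi b.
  by rewrite integral0_eq// => x nO; rewrite p0.
apply: filterS2 (H true) (H false) => w h1 h2 []; [exact: h1|exact: h2].
Qed.

Lemma sct_opt_tour n w : (forall b i, Omega (W (b, i) w)) ->
  sct_opt n (X^~ w) (Y^~ w) = tour_conf ell (fun bi : bool * 'I_n => W (bi.1, val bi.2) w).
Proof.
move=> wO; rewrite /tour_conf /tour_min /minperm /sct_opt.
have E s : sct_tour_len (X^~ w) (Y^~ w) s = tour_len ell
    (fun i : 'I_n => W (true, val i) w) (fun i => W (false, val i) w) s.
  by apply: eq_bigr => k _; rewrite /ell !retract_distE.
by rewrite E; apply: eq_bigr => s _.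
Qed.

Lemma match_cost_assign n w b (U V : nat -> nat) : (forall b i, Omega (W (b, i) w)) ->
  match_cost n (fun i => W (b, U i) w) (fun i => W (b, V i) w) =
  assign_conf ell (fun ci : bool * 'I_n => W (b, if ci.1 then V ci.2 else U ci.2) w).
Proof.
move=> wO; rewrite /assign_conf /assign_min /minperm /match_cost.
have E (s : {perm 'I_n}) : \sum_(i < n) enorm ((W (b, U i) w : vecR R d) - W (b, V (s i)) w)
  = assign_len ell (fun i : 'I_n => W (b, U i) w) (fun i => W (b, V i) w) s.
  by apply: eq_bigr => k _; rewrite /ell !retract_distE.
by rewrite E; apply: eq_bigr => s _.
Qed.

(** Redrawing the delivery turns independence into an iterated integral over the sample space, and
    each of the two integrals is then carried to a density. Outside [Omega] the densities vanish, so
    the two distances may differ there. *)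
Lemma mean_distE :
  \int[P]_w ell (W (false, 0%N) w) (W (true, 0%N) w) = mean_dist lam phiP phiD.
Proof.
have [mP P0 PO _] := dP; have [mD D0 DO _] := dD.
have bell := retract_dist_bmeas cO Oa0.
pose Z (b : bool) := W (b, 0%N).
have iZ : indep P Z by apply: (indep_inj (h := fun b => (b, 0%N)) _ family_indep) => ? ? [].
have bf : bmeas (fun z : conf (Rd R d) bool => ell (z false) (z true)).
  apply: (@bmeas_comp _ _ _ _ _ (fun z : conf (Rd R d) bool => (z false, z true)) _ _ bell).
  by apply: measurable_fun_pair; exact: measurable_coord.
pose k x := \int[P]_v ell (Y 0%N v) x.
have bk : bmeas k.
  apply: (bmeas_fubini P (h := fun xv : Rd R d * T => ell (Y 0%N xv.2) xv.1)).
  apply: (@bmeas_comp _ _ _ _ _ (fun xv : Rd R d * T => (Y 0%N xv.2, xv.1)) _ _ bell).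
  apply: measurable_fun_pair => //; apply: measurableT_comp => //.
  by case: (hY 0%N).
have k0 x : 0 <= k x by apply: Rintegral_ge0 => v _; exact: enorm_ge0.
have -> : \int[P]_w ell (W (false, 0%N) w) (W (true, 0%N) w) = \int[P]_w k (X 0%N w).
  exact: (Rintegral_resample iZ false bf).
have [mX PX] := hX 0%N; have [mY PY] := hY 0%N.
rewrite /Rintegral /mean_dist; congr fine.
rewrite (ge0_integral_density mX mP P0 PX (f := fun x => (k x)%:E)); last 2 first.
- by apply/measurable_EFinP; case: bk.
- by move=> x; rewrite lee_fin.
apply: eq_integral => x _.
have [Ox|nOx] := pselect (Omega x); last first.
  rewrite PO// mule0 integral0_eq// => y _.
  by rewrite mulr0 mul0r.
have bx : bmeas (fun y => ell y x).
  exact: (@bmeas_comp _ _ _ _ _ (fun y : Rd R d => (y, x)) _ (pair2_measurable _) bell).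
have -> : (k x)%:E = (\int[lam]_y ((ell y x)%:E * (phiD y)%:E))%E.
  rewrite -(ge0_integral_density mY mD D0 PY (f := fun y => (ell y x)%:E)).
  - rewrite /k EFin_bmeas_Rintegral//; exact: (@bmeas_comp _ _ _ _ _ (Y 0%N) _ mY bx).
  - by apply/measurable_EFinP; case: bx.
  - by move=> y; rewrite lee_fin; exact: enorm_ge0.
rewrite muleC -ge0_integralZl//.
- apply: eq_integral => y _; rewrite -!EFinM; congr (_%:E).
  have [Oy|nOy] := pselect (Omega y); last by rewrite DO// !mulr0.
  by rewrite /ell retract_distE//; ring.
- apply: emeasurable_funM; apply/measurable_EFinP => //; by case: bx.
- by move=> y _; rewrite -EFinM lee_fin mulr_ge0//; exact: enorm_ge0.
- by rewrite lee_fin.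
Qed.

Let coupling_cost (ga : probability (Rd R d * Rd R d)%type R) :
  coupling lam Omega phiD phiP ga ->
  (\int[ga]_z (enorm ((z.2 : vecR R d) - z.1))%:E = (\int[ga]_z ell z.1 z.2)%:E)%E.
Proof.
move=> [ga0 _ _]; have bell := retract_dist_bmeas cO Oa0.
rewrite EFin_bmeas_Rintegral//; apply: ae_eq_integral => //.
- apply/measurable_EFinP; under eq_fun do rewrite enorm_distC.
  exact: measurable_enorm_dist.
- by apply/measurable_EFinP; case: bell.
exists (~` ((Omega : set (Rd R d)) `*` (Omega : set (Rd R d)))); split => //.
  by apply: measurableC; exact: measurableX.
move=> [u v] /= h [Ou Ov]; apply: h => _.
by rewrite /ell retract_distE// enorm_distC.
Qed.

(** [fine] reads an infinite infimum as [0], so finiteness comes first: the joint law of a delivery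
    and a pickup is a coupling of finite cost. *)
Lemma wasserstein_approx (e : R) : 0 < e ->
  exists2 ga : probability (Rd R d * Rd R d)%type R, coupling lam Omega phiD phiP ga &
    \int[ga]_z ell z.1 z.2 <= fine (wasserstein lam Omega phiD phiP) + e.
Proof.
move=> e0; have bell := retract_dist_bmeas cO Oa0.
have [mX PX] := hX 0%N; have [mY PY] := hY 0%N.
have mf : measurable_fun setT (fun w => (Y 0%N w, X 0%N w)) by exact: measurable_fun_pair.
pose F : {mfun T >-> (Rd R d * Rd R d)%type} :=
  HB.pack (fun w => (Y 0%N w, X 0%N w)) (isMeasurableFun.Build _ _ _ _ _ mf).
pose ga0 : probability (Rd R d * Rd R d)%type R := distribution P F.
have c0 : coupling lam Omega phiD phiP ga0.
  split => [|A mA|A mA].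
  - have [N [mN N0 NO]] := family_in_support.
    apply: (@subset_measure0 _ _ _ P _ N) => //.
      rewrite -[X in measurable X]setTI; apply: (mf measurableT); apply: measurableC.
      exact: measurableX.
    move=> w /= nw; apply: NO => /= wO; apply: nw; split.
      exact: (wO false 0%N).
    exact: (wO true 0%N).
  - rewrite -PY//; congr (P _); apply/seteqP; split => [w []//|w Aw]; by split.
  - rewrite -PX//; congr (P _); apply/seteqP; split => [w []//|w Aw]; by split.
have Wfin : wasserstein lam Omega phiD phiP \is a fin_num.
  rewrite ge0_fin_numE.
    apply: (@le_lt_trans _ _ (\int[ga0]_z ell z.1 z.2)%:E); last exact: ltry.
    by apply: ereal_inf_lbound; exists ga0; split => //; rewrite coupling_cost.
  apply: le_ereal_inf_tmp => _ [ga [cga ->]].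
  by apply: integral_ge0 => z _; rewrite lee_fin; exact: enorm_ge0.
have [c [ga [cga ->]]] := lb_ereal_inf_adherent e0 Wfin.
rewrite coupling_cost// => /ltW; rewrite -/(wasserstein lam Omega phiD phiP).
by rewrite -[wasserstein _ _ _ _]fineK// -EFinD lee_fin; exists ga.
Qed.

Let c := mean_dist lam phiP phiD + fine (wasserstein lam Omega phiD phiP).

Let tour n w := tour_conf ell (fun bi : bool * 'I_n => W (bi.1, val bi.2) w).

(** Even and odd indices split the sequence of side [b] into two sequences that do not change with
    [n], as the almost sure limit of the matching cost requires. *)
Let pair_idx b n (ci : bool * 'I_n) : bool * nat :=
  (b, if ci.1 then (ci.2).*2.+1 else (ci.2).*2).

Let pair_idx_inj b n : injective (@pair_idx b n).
Proof.
move=> [[] i] [[] j] [] => [/double_inj/val_inj -> //|/eqP|/eqP|/double_inj/val_inj -> //];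
  by rewrite -!muln2 => /eqP/(congr1 odd); rewrite /= !oddM !andbF.
Qed.

Let self_assign b n w := assign_conf ell (fun ci : bool * 'I_n => W (pair_idx b ci) w).

(** After replacement the first [n] points of side [b] face fresh points of the same side, taken
    from index [n] on. This split changes with [n], but only its law matters, and [E_side] compares
    it with the parity split. *)
Let side_idx b n (ci : bool * 'I_n) : bool * nat := (b, if ci.1 then val ci.2 else (n + ci.2)%N).

Let side_idx_inj b n : injective (@side_idx b n).
Proof.
move=> [[] i] [[] j] [] => [/val_inj -> //|ij|ij|/eqP].
- by have := ltn_ord i; rewrite ij ltnNge leq_addr.
- by have := ltn_ord j; rewrite -ij ltnNge leq_addr.
- by rewrite eqn_add2l => /eqP/val_inj ->.
Qed.

Let E_side b n :
  \int[P]_w assign_conf ell (fun ci : bool * 'I_n => W (side_idx b ci) w) =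
  \int[P]_w self_assign b n w.
Proof.
apply: (indep_Rintegral_eq (indep_inj (@side_idx_inj b n) family_indep)
  (indep_inj (@pair_idx_inj b n) family_indep) _
  (bmeas_assign_conf (retract_dist_bmeas cO Oa0) n)).
by move=> ci; exact: family_law.
Qed.

(** A coupling within [1 / n] of the infimum loses [1] over [n] replacements. Side [b] is kept and
    the other one replaced. *)
Lemma E_assign_le b n : (0 < n)%N ->
  \int[P]_w assign_conf ell (fun bi : bool * 'I_n => W (bi.1, val bi.2) w) <=
  n%:R * fine (wasserstein lam Omega phiD phiP) + 1 + \int[P]_w self_assign b n w.
Proof.
move=> n0; have n0' : 0 < n%:R :> R by rewrite ltr0n.
have [|ga [gaO ga1 ga2] gaW] := @wasserstein_approx n%:R^-1; first by rewrite invr_gt0.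
have bell := retract_dist_bmeas cO Oa0.
have cost : n%:R * \int[ga]_z ell z.1 z.2 <= n%:R * fine (wasserstein lam Omega phiD phiP) + 1.
  apply: le_trans (ler_wpM2l (ltW n0') gaW) _.
  by rewrite mulrDr mulfV ?gt_eqF.
have L1 i : law_eq ga P fst (W (false, i)).
  move=> A mA; have [_ ->//] := family_density false i; rewrite -ga1//.
  by congr (ga _); apply/seteqP; split => [[u v]|[u v] []].
have L2 i : law_eq ga P snd (W (true, i)).
  move=> A mA; have [_ ->//] := family_density true i; rewrite -ga2//.
  by congr (ga _); apply/seteqP; split => [[u v]|[u v] []].
(* The flag is twisted by [~~ b] so that the points to be replaced always carry [false], as in
   [E_assign_coupling]. *)
pose h (k : (bool * 'I_n) + 'I_n) : bool * nat :=
  match k with inl ci => (ci.1 (+) ~~ b, val ci.2) | inr i => (b, (n + i)%N) end.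
have hinj : injective h.
  move=> [[a i]|i] [[a' j]|j] [].
  - by move=> /addIb -> /val_inj ->.
  - by move=> _ ij; have := ltn_ord i; rewrite ij ltnNge leq_addr.
  - by move=> _ ij; have := ltn_ord j; rewrite -ij ltnNge leq_addr.
  - by move=> /eqP; rewrite eqn_add2l => /eqP/val_inj ->.
have iH := indep_inj hinj family_indep.
rewrite -E_side.
case: b @h hinj iH => h hinj iH.
  have := @E_assign_coupling _ _ _ _ bell (@retract_dist_triangle _ _ _ _) _ _ P n _ _ _ ga fst snd
    iH measurable_fst measurable_snd (fun i => L1 i) (fun i => L2 (n + i)%N).
  rewrite /h => H.
  have E1 : (fun w => assign_conf ell (fun bi : bool * 'I_n => W (bi.1 (+) ~~ true, val bi.2) w)) =
     (fun w => assign_conf ell (fun bi : bool * 'I_n => W (bi.1, val bi.2) w)).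
    by apply/funext => w; congr assign_conf; apply/funext => -[[] i].
  move: H; rewrite E1 => /le_trans; apply; apply: lerD => //.
(* For [b = false] the pickups are replaced: the coupling is read backwards, and the symmetry of the
   assignment undoes the exchange of sides. *)
have := @E_assign_coupling _ _ _ _ bell (@retract_dist_triangle _ _ _ _) _ _ P n _ _ _ ga snd fst
  iH measurable_snd measurable_fst (fun i => L2 i) (fun i => L1 (n + i)%N).
rewrite /h => H.
have E1 : (fun w => assign_conf ell (fun bi : bool * 'I_n => W (bi.1 (+) ~~ false, val bi.2) w)) =
   (fun w => assign_conf ell (fun bi : bool * 'I_n => W (bi.1, val bi.2) w)).
  by apply/funext => w; rewrite /assign_conf assign_min_sym//; exact: retract_dist_sym.
move: H; rewrite E1 => /le_trans; apply; apply: lerD.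
  apply: le_trans cost; rewrite ler_wpM2l// le_eqVlt; apply/orP; left; apply/eqP.
  by apply: eq_Rintegral => z _; exact: retract_dist_sym.
rewrite le_eqVlt; apply/orP; left; apply/eqP; apply: eq_Rintegral => w _.
by congr assign_conf; apply/funext => -[[] i].
Qed.

Let idx_inj n : injective (fun bi : bool * 'I_n => (bi.1, val bi.2)).
Proof. by move=> [b i] [b' i'] [-> /val_inj ->]. Qed.

Section Bounded.
Variable D : R.
Hypotheses (D0 : 0 <= D) (ellD : forall u v, 0 <= ell u v <= D).

Lemma E_tour_mean_le b n : (0 < n)%N ->
  \int[P]_w tour n w <= n%:R * c + \int[P]_w self_assign b n w + (1 + 2 * D * (1 + ln n%:R)).
Proof.
move=> n0; have := E_tour_le D0 (retract_dist_bmeas cO Oa0) ellD (@retract_dist_sym _ _ _ _)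
  family_indep family_law n.
rewrite mean_distE => /le_trans; apply.
have := E_assign_le b n0.
have := ler_wpM2l (mulr_ge0 (ler0n R 2) D0) (harmonic_le_ln R n0).
rewrite -/(tour n) /c mulrDr; lra.
Qed.

Lemma tour_tail n (t : R) : (2 * (2 * D)) ^+ 2 <= n%:R -> (0 < n)%N ->
  (P [set w | (\int[P]_v tour n v + t <= tour n w)%R] <=
    (expR (4 * (2 * D) ^+ 2 - t / Num.sqrt n%:R))%:E)%E.
Proof.
apply: (concentration_tail family_indep (h := fun n (bi : bool * 'I_n) => (bi.1, val bi.2)) idx_inj
  (f := fun n => @tour_conf _ _ _ ell n)).
- by rewrite mulr_ge0.
- by move=> k; apply: bmeas_tour_conf; exact: retract_dist_bmeas.
- by move=> k z j u; apply: tour_conf_diff.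
Qed.

Lemma tour_ae : {ae P, forall w, \forall n \near \oo,
  tour n w <= \int[P]_v tour n v + 2 * (Num.sqrt n%:R * ln n%:R)}.
Proof.
apply: (concentration_ae family_indep (h := fun n (bi : bool * 'I_n) => (bi.1, val bi.2)) idx_inj
  (f := fun n => @tour_conf _ _ _ ell n) (c := 2 * D)).
- by rewrite mulr_ge0.
- by move=> k; apply: bmeas_tour_conf; exact: retract_dist_bmeas.
- by move=> k z j u; apply: tour_conf_diff.
Qed.

(** Concentration of the negated cost: the mean is bounded by a value, the direction needed to pass
    from almost sure limits to means. *)
Lemma self_assign_ae b : {ae P, forall w, \forall n \near \oo,
  \int[P]_v self_assign b n v <= self_assign b n w + 2 * (Num.sqrt n%:R * ln n%:R)}.
Proof.
have bell := retract_dist_bmeas cO Oa0.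
have := @concentration_ae _ _ _ _ _ P _ _ family_indep (@pair_idx b) (@pair_idx_inj b)
  (fun n z => - assign_conf ell z) (2 * D).
move=> /(_ (mulr_ge0 (ler0n _ _) D0)) H.
apply: filterS (H _ _) => [w|n|n z j u].
- apply: filterS => n.
  under eq_Rintegral do rewrite -mulN1r.
  rewrite bmeas_RintegralZl.
    by rewrite -/(self_assign b n w) /self_assign mulN1r; lra.
  exact: (bmeas_comp (measurable_family (indep_inj (@pair_idx_inj b n) family_indep))
    (bmeas_assign_conf bell n)).
- exact/bmeasN/bmeas_assign_conf.
- by rewrite -opprD normrN; apply: (assign_conf_diff D0 ellD).
Qed.

End Bounded.

Let ae_proper : ProperFilter (almost_everywhere P).
Proof. by apply: ae_properfilter_algebraOfSetsType; rewrite /= probability_setT. Qed.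

(** * Almost sure bound in dimension at least three *)

Section HighDimension.
Variables (b : bool) (beta : R).
Hypotheses (d3 : (3 <= d)%N) (hbeta : matching_constant lam beta).
Let K := beta * Rintegral lam Omega (fun x => powR (phi b x) (1 - d%:R^-1)).

Let matching_limit : {ae P, forall w,
  (fun n => match_cost n (fun i => W (b, i.*2) w) (fun i => W (b, i.*2.+1) w) / scale_d R d n)
    @ \oo --> K}.
Proof.
apply: (hbeta (U := fun i => W (b, i.*2)) (V := fun i => W (b, i.*2.+1)) cO (dphi b)).
  by move=> i; split; exact: family_density.
pose h (ci : bool * nat) : bool * nat := (b, if ci.1 then (ci.2).*2 else (ci.2).*2.+1).
have hinj : injective h.
  move=> [[] i] [[] j] [] => [/double_inj -> //|/eqP|/eqP|/double_inj -> //];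
    by rewrite -!muln2 => /eqP/(congr1 odd); rewrite /= !oddM !andbF.
have [_ H] := indep_inj hinj family_indep.
apply: (eq_ind (fun j => W (h j)) (mutually_independent P) H).
by apply/funext => -[[] i].
Qed.

(** The mean does not depend on the outcome, so it may be estimated at any [w] in the intersection
    of three events of probability one. *)
Let self_assign_limit (e : R) : 0 < e -> \forall n \near \oo,
  \int[P]_v self_assign b n v <= (K + e) * scale_d R d n + 2 * (Num.sqrt n%:R * ln n%:R).
Proof.
move=> e0; have [D D0 ellD] := retract_dist_bound cO Oa0.
have [w [h1 [h2 wO]]] := @filter_ex _ _ ae_proper _ (filterI (self_assign_ae D0 ellD b)
  (filterI matching_limit family_in_support)).
have h2' : \forall n \near \oo,
    match_cost n (fun i => W (b, i.*2) w) (fun i => W (b, i.*2.+1) w) / scale_d R d n < K + e.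
  by apply: (cvgr_lt K h2); rewrite ltrDl.
near=> n.
have n0 : (0 < n)%N by near: n; exists 1%N.
have s0 : 0 < scale_d R d n by rewrite powR_gt0// ltr0n.
have : \int[P]_v self_assign b n v <= self_assign b n w + 2 * (Num.sqrt n%:R * ln n%:R).
  by near: n.
move=> /le_trans; apply; rewrite lerD2r.
have : match_cost n (fun i => W (b, i.*2) w) (fun i => W (b, i.*2.+1) w) / scale_d R d n < K + e.
  by near: n.
by rewrite ltr_pdivrMr// (match_cost_assign n b double (fun i => i.*2.+1) wO) => /ltW.
Unshelve. all: by end_near. Qed.

Lemma limsup_tour_le : {ae P, forall w,
  (limn_esup (fun n => ((sct_opt n (X^~ w) (Y^~ w) - n%:R * c) / scale_d R d n)%:E) <= K%:E)%E}.
Proof.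
have [D D0 ellD] := retract_dist_bound cO Oa0.
apply: filterS2 (tour_ae D0 ellD) family_in_support => w ht wO.
apply/lee_addgt0Pr => e e0; rewrite -EFinD.
set u := (fun n => _).
(* The limsup is an infimum of suprema over the sets of the filter, so one set with the bound
   suffices. *)
suff : \forall n \near \oo, (u n <= (K + e)%:E)%E.
  move=> Hu; apply: (@le_trans _ _ (ereal_sup [set u n | n in [set n | (u n <= (K + e)%:E)%E]])).
    by apply: ereal_inf_lbound; exists [set n | (u n <= (K + e)%:E)%E].
  by apply: ge_ereal_sup => _ [n /= un <-].
have e2 : 0 < e / 2 by rewrite divr_gt0.
(* [5 + 2 * D] absorbs two deviations of [2 sqrt n ln n] and the error [1 + 2 D (1 + ln n)] of the
   mean. *)
have K0 : 0 <= 5 + 2 * D by lra.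
have h1 := scale_dominates d3 K0 e2.
have h2 := self_assign_limit e2.
near=> n.
have n0 : (0 < n)%N by near: n; exists 1%N.
have s0 : 0 < scale_d R d n by rewrite powR_gt0// ltr0n.
rewrite /u lee_fin ler_pdivrMr// (sct_opt_tour n wO) -/(tour n w).
have g1 : tour n w <= \int[P]_v tour n v + 2 * (Num.sqrt n%:R * ln n%:R) by near: n.
have g2 := E_tour_mean_le D0 ellD b n0.
have g3 : \int[P]_v self_assign b n v <=
  (K + e / 2) * scale_d R d n + 2 * (Num.sqrt n%:R * ln n%:R) by near: n.
have g4 : (5 + 2 * D) * (Num.sqrt n%:R * ln n%:R + 1) <= e / 2 * scale_d R d n by near: n.
have l0 : 0 <= ln n%:R :> R by rewrite ln_ge0// ler1n.
have sq1 : 1 <= Num.sqrt n%:R :> R by rewrite -[leLHS]sqrtr1 ler_sqrt// ler1n.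
have g5 : ln n%:R <= Num.sqrt n%:R * ln n%:R :> R by rewrite ler_peMl.
have g6 : D * ln n%:R <= D * (Num.sqrt n%:R * ln n%:R) by rewrite ler_wpM2l.
move: g1 g2 g3 g4 g5 g6.
rewrite (mulrDl K) (mulrDl K).
move: (\int[P]_v tour n v) (\int[P]_v self_assign b n v) (Num.sqrt n%:R * ln n%:R : R)
  (scale_d R d n) (ln n%:R : R) l0 (tour n w) => t sa s sc l l0 tw.
move: (n%:R * c) => nc g1 g2 g3 g4 g5 g6.
have : 0 <= D * 1 by rewrite mulr1.
lra.
Unshelve. all: by end_near. Qed.

End HighDimension.

(** * Bound in probability in the plane *)

Lemma measurable_sct_opt n : measurable_fun setT (fun w => sct_opt n (X^~ w) (Y^~ w)).
Proof.
have ml i j : measurable_fun setT (fun w => enorm ((W i w : vecR R d) - W j w)).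
  apply: (@measurableT_comp _ _ _ _ _ _ (fun p : Rd R d * Rd R d => enorm ((p.1 : vecR R d) - p.2))
    _ (fun w => (W i w, W j w))); first exact: measurable_enorm_dist.
  by apply: measurable_fun_pair; case: family_indep.
have mt s : measurable_fun setT (fun w => @sct_tour_len R d n (X^~ w) (Y^~ w) s).
  apply: measurable_sum => k; apply: measurable_funD.
    exact: (ml (false, val (s k)) (true, val (s k))).
  exact: (ml (true, val (s (ordS k))) (false, val (s k))).
exact: (measurable_bigmin _ (mt 1%g) mt).
Qed.

(** The deviation is taken equal to the scale [sqrt (n ln n)], and its probability, at most
    [expR (4 (2 D)^2 - sqrt (ln n))], tends to [0]. The planar estimate enters as a hypothesis so
    that [d] stays a variable. *)
Lemma planar_tour_le (C : R) : 0 <= C ->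
  (forall n (Z : bool * 'I_n -> T -> Rd R d),
    indep P Z -> (forall i j, law_eq P P (Z i) (Z j)) ->
    (3 <= n)%N -> 1 <= ln n%:R :> R ->
    \int[P]_w assign_conf ell (Z^~ w) <= C * Num.sqrt (n%:R * ln n%:R)) ->
  exists gamma : R, 0 < gamma /\
   (fun n => P [set w | (sct_opt n (X^~ w) (Y^~ w) - n%:R * c)
       / Num.sqrt (n%:R * ln n%:R) <= gamma]) @ \oo --> 1%E.
Proof.
move=> C0 planar; have [D D0 ellD] := retract_dist_bound cO Oa0.
(* [C] comes from the matching, [4 D] from [2 D (1 + ln n)], and [2] from the deviation and the
   coupling error, as [1] and [ln n] are at most the scale. *)
exists (C + 4 * D + 2); split; first by rewrite ltr_wpDl// addr_ge0// mulr_ge0.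
pose A n := [set w | (sct_opt n (X^~ w) (Y^~ w) - n%:R * c)
       / Num.sqrt (n%:R * ln n%:R) <= C + 4 * D + 2].
have mA n : measurable (A n).
  rewrite -[A n]setTI; apply: measurable_fun_le => //.
  apply: measurable_funM => //; apply: measurable_funB => //.
  exact: measurable_sct_opt.
have [N [mN PN NO]] := family_in_support.
pose e n : R := expR (4 * (2 * D) ^+ 2 - Num.sqrt (ln n%:R)).
have lnM (M : R) : \forall n \near \oo, M <= ln n%:R :> R.
  exists (Num.truncn (expR M)).+1 => // n /= Mn.
  have hn : expR M <= n%:R by rewrite (le_trans (ltW (truncnS_gt _)))// ler_nat.
  by rewrite -[M]expRK ler_ln ?posrE ?expR_gt0// (lt_le_trans _ hn)// expR_gt0.
have e0 : (fun n => e n) @ \oo --> (0 : R).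
  apply/cvgr0Pnorm_le => eps eps0.
  pose M := 4 * (2 * D) ^+ 2 - ln eps.
  apply: filterS (lnM (M ^+ 2)) => n Mn.
  rewrite ger0_norm ?expR_ge0// -[leRHS]lnK ?posrE// ler_expR lerBlDr.
  rewrite -lerBlDl -/M (le_trans (ler_norm _))// -sqrtr_sqr ler_wsqrtr//.
have AP : \forall n \near \oo, ((1 - e n)%:E <= P (A n) <= 1%E)%E.
  near=> n; apply/andP; split; last exact: probability_le1.
  have n3 : (3 <= n)%N by near: n; exists 3%N.
  have n0 : (0 < n)%N by exact: leq_trans n3.
  have n0' : 0 < n%:R :> R by rewrite ltr0n.
  have l1 : 1 <= ln n%:R :> R by near: n.
  have Dn : (2 * (2 * D)) ^+ 2 <= n%:R.
    near: n; exists (Num.truncn ((2 * (2 * D)) ^+ 2)).+1 => // m /= Bm.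
    by apply: le_trans (ltW (truncnS_gt _)) _; rewrite ler_nat.
  pose s : R := Num.sqrt (n%:R * ln n%:R).
  have l0 : 0 < ln n%:R :> R by exact: lt_le_trans l1.
  have s0 : 0 < s by rewrite sqrtr_gt0 mulr_gt0.
  have sl : ln n%:R <= s.
    rewrite -[leLHS](gtr0_norm l0) -sqrtr_sqr ler_wsqrtr// expr2 ler_wpM2r ?(ltW l0)//.
    exact/ltW/ln_sublinear.
  have st : s / Num.sqrt n%:R = Num.sqrt (ln n%:R).
    by rewrite /s sqrtrM ?(ltW n0')// mulrAC mulfV ?mul1r// gt_eqF// sqrtr_gt0.
  have tail := tour_tail D0 ellD s Dn n0.
  set B := [set w | _] in tail.
  have mB : measurable B.
    rewrite -[B]setTI; apply: measurable_fun_le => //.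
    have [] := bmeas_comp (measurable_family (indep_inj (@idx_inj n) family_indep))
      (bmeas_tour_conf (retract_dist_bmeas cO Oa0) n).
    by [].
  have sub : ~` A n `<=` B `|` N.
    move=> w nAw; apply: contrapT => /not_orP[nBw nNw]; apply: nAw.
    have wO : forall b i, Omega (W (b, i) w) by apply: contrapT => h; apply: nNw; exact: NO.
    rewrite /A /= -/s ler_pdivrMr// (sct_opt_tour n wO) -/(tour n w).
    have g1 : tour n w < \int[P]_v tour n v + s by rewrite ltNge; apply/negP.
    have g2 := E_tour_mean_le D0 ellD true n0.
    have g3 := planar n _ (indep_inj (@pair_idx_inj true n) family_indep)
      (fun i j => family_law _ _ _) n3 l1; rewrite -/s -/(self_assign true n) in g3.
    have g4 : D * ln n%:R <= D * s by rewrite ler_wpM2l.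
    have g5 : D * 1 <= D * s by rewrite ler_wpM2l// (le_trans l1).
    have g6 : 1 <= s by exact: le_trans sl.
    move: g1 g2 g3 g4 g5 g6.
    move: (\int[P]_v tour n v) (\int[P]_v self_assign true n v) (tour n w) (n%:R * c).
    by move=> t sa tw nc; lra.
  have PAC : (P (~` A n) <= (e n)%:E)%E.
    apply: (@le_trans _ _ (P (B `|` N))).
      by apply: le_measure; rewrite ?inE//; [exact: measurableC|exact: measurableU].
    apply: le_trans (measureU2 _ mB mN) _; rewrite [X in (_ + X)%E]PN adde0.
    by apply: le_trans tail _; rewrite st.
  move: PAC; rewrite probability_setC//.
  by rewrite -[P (A n)]fineK ?fin_num_measure// -EFinB !lee_fin; lra.
apply: (squeeze_cvge AP); last exact: cvg_cst.
apply: cvg_EFin; first by apply: nearW.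
rewrite -[X in _ --> X]subr0; apply: cvgB => //; exact: cvg_cst.
Unshelve. all: by end_near. Qed.

End Law.

Theorem theorem3 (R : realType) (d : nat) (lam : {measure set Rd R d -> \bar R})
  (Omega : set (vecR R d)) (phiP phiD : Rd R d -> R)
  (dT : measure_display) (T : measurableType dT) (P : probability T R)
  (X Y : nat -> T -> Rd R d) :
  (2 <= d)%N ->
  is_lebesgue lam -> compact Omega ->
  is_density_on lam Omega phiP -> is_density_on lam Omega phiD ->
  (forall i, has_density P lam (X i) phiP) ->
  (forall i, has_density P lam (Y i) phiD) ->
  mutually_independent P (fun bi : bool * nat => if bi.1 then X bi.2 else Y bi.2) ->
  let c := mean_dist lam phiP phiD + fine (wasserstein lam Omega phiD phiP) in
  let L n w := sct_opt n (X^~ w) (Y^~ w) in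
  ((3 <= d)%N -> forall beta : R, matching_constant lam beta ->
     let kappa := Num.min
       (beta * Rintegral lam Omega (fun x => powR (phiP x) (1 - d%:R^-1)))
       (beta * Rintegral lam Omega (fun x => powR (phiD x) (1 - d%:R^-1))) in
     {ae P, forall w,
        (limn_esup (fun n => ((L n w - n%:R * c) / @scale_d R d n)%:E)
           <= kappa%:E)%E})
  /\
  (d = 2%N -> exists gamma : R, 0 < gamma /\
     (fun n => P [set w | (L n w - n%:R * c) / Num.sqrt (n%:R * ln n%:R) <= gamma])
       @ \oo --> 1%E).
Proof.
move=> _ _ cO dP dD hX hY iXY c L.
have [a0 Oa0] := density_support_nonempty dP.
split => [d3 beta hbeta kappa|d2].
  (* Each choice of the side that is kept gives one of the two terms of the minimum. *)
  have HP := limsup_tour_le cO dP dD hX hY iXY Oa0 true d3 hbeta.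
  have HD := limsup_tour_le cO dP dD hX hY iXY Oa0 false d3 hbeta.
  rewrite /kappa minEle; case: ifPn => _; [exact: HP|exact: HD].
subst d.
have [C C0 HC] := E_assign_planar cO Oa0.
apply: (planar_tour_le cO dP dD hX hY iXY Oa0 C0) => n Z iZ eqZ n3 l1.
by apply: HC => //; exact: retract_dist_bmeas.
Qed.
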